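(* For every $c\in\left[\frac{\log 3}{2},\log 2\right)$, setting $\lambda=\lambda(d)=e^{-cd}$, the pressure $g_d(\lambda)$ of the hard sphere model in $\mathbb{R}^d$ satisfies, as $d\to\infty$, $$g_d(\lambda)\ \ge\ \left(\frac{(\log 2-c)^2}{2}+o_d(1)\right)\cdot\frac{d^2}{2^d},$$ where $o_d(1)$ denotes a quantity tending to $0$ as $d\to\infty$.
   Context: $\log$ is the natural logarithm and $d(x,y)$ is Euclidean distance. Let $r_d$ be the radius of a ball of volume $1$ in $\mathbb{R}^d$. For a bounded, measurable set $S\subset\mathbb{R}^d$ and $\lambda>0$, put $\hat Z_S(0)=1$ and $$\hat Z_S(k)=\frac{1}{k!}\int_{S^k}\mathbf{1}\{d(x_i,x_j)>2r_d\ \text{for all } i\neq j\}\,dx_1\cdots dx_k \quad (k\ge 1),\qquad Z_S(\lambda)=\sum_{k\ge 0}\lambda^k\hat Z_S(k).$$ Let $B_n$ be the ball of volume $n$ centered at the origin in $\mathbb{R}^d$ (radius $n^{1/d}r_d$). The pressure of the hard sphere model is $$g_d(\lambda)=\lim_{n\to\infty}\frac1n\log Z_{B_n}(\lambda),\qquad \lambda>0$$ (the limit exists, by subadditivity). *)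

(* Defs.v *)
From HB Require Import structures.
From mathcomp Require Import all_boot all_order all_algebra.
From mathcomp Require Import all_classical all_reals all_analysis.

Set Implicit Arguments.
Unset Strict Implicit.
Unset Printing Implicit Defensive.

Import Order.TTheory GRing.Theory Num.Theory.
Import numFieldNormedType.Exports.

Local Open Scope classical_set_scope.
Local Open Scope ring_scope.

(* Measures on [n.-tuple T], for the library's product sigma-algebra. *)
Section tuple_measure.
Context (d : measure_display) (T : measurableType d) (R : realType).
Local Open Scope ereal_scope.

Definition tcons n (p : T * n.-tuple T) : n.+1.-tuple T := [tuple of p.1 :: p.2].

Lemma measurable_tcons n : measurable_fun [set: T * n.-tuple T] (@tcons n).
Proof. exact: measurable_cons. Qed.

Definition cons_measure n (mu : {sigma_finite_measure set T -> \bar R})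
    (nu : {sigma_finite_measure set (n.-tuple T) -> \bar R}) :
    set (n.+1.-tuple T) -> \bar R :=
  pushforward (mu \x nu) (@tcons n).

Section instances.
Variables (n : nat) (mu : {sigma_finite_measure set T -> \bar R}).
Variable nu : {sigma_finite_measure set (n.-tuple T) -> \bar R}.

Let preimage_tcons A : measurable A -> measurable (@tcons n @^-1` A).
Proof.
by move=> mA; rewrite -[X in measurable X]setTI; exact: measurable_tcons.
Qed.

Let cons_measure0 : cons_measure mu nu set0 = 0.
Proof. by rewrite /cons_measure /pushforward preimage_set0 measure0. Qed.

Let cons_measure_ge0 A : 0 <= cons_measure mu nu A.
Proof. by rewrite /cons_measure /pushforward. Qed.

Let cons_measure_sigma_additive : semi_sigma_additive (cons_measure mu nu).
Proof.
move=> F mF tF mUF; rewrite /cons_measure /pushforward preimage_bigcup.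
apply: measure_semi_sigma_additive.
- by move=> k; exact: preimage_tcons.
- apply/trivIsetP => /= i j _ _ ij; rewrite -preimage_setI.
  by move/trivIsetP : tF => /(_ _ _ _ _ ij) ->//; rewrite preimage_set0.
- by rewrite -preimage_bigcup; exact: preimage_tcons.
Qed.

HB.instance Definition _ := isMeasure.Build _ _ _ (cons_measure mu nu)
  cons_measure0 cons_measure_ge0 cons_measure_sigma_additive.

Let cons_measure_sigma_finite : sigma_finite setT (cons_measure mu nu).
Proof.
have /sigma_finiteP[F [TF ndF Foo]] := sigma_finiteT mu.
have /sigma_finiteP[G [TG ndG Goo]] := sigma_finiteT nu.
pose g (t : n.+1.-tuple T) : T * n.-tuple T := (thead t, [tuple of behead t]).
have gK p : g (tcons p) = p.
  by case: p => x t; rewrite /g /tcons /= theadE; congr pair; exact: val_inj.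
have mg : measurable_fun setT g.
  apply/measurable_fun_pairP; split; first exact: measurable_tnth.
  exact: measurable_behead.
exists (fun k => g @^-1` (F k `*` G k)).
  rewrite -preimage_bigcup predeqE => t; split=> // _ /=.
  have [i _ Fi] : (\bigcup_i F i) (g t).1 by rewrite -TF.
  have [j _ Gj] : (\bigcup_i G i) (g t).2 by rewrite -TG.
  exists (maxn i j) => //; split.
  - by move: (g t).1 Fi; exact/subsetPset/ndF/leq_maxl.
  - by move: (g t).2 Gj; exact/subsetPset/ndG/leq_maxr.
move=> k; have [mFk Fk] := Foo k; have [mGk Gk] := Goo k.
have mFG : measurable (F k `*` G k) by exact: measurableX.
split; first by rewrite -[X in measurable X]setTI; exact: mg.
rewrite /cons_measure /pushforward.
rewrite [X in (mu \x nu) X](_ : _ = F k `*` G k); last first.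
  by apply/seteqP; split=> p; rewrite /preimage /mkset gK.
by rewrite product_measure1E// lte_mul_pinfty// ge0_fin_numE.
Qed.

HB.instance Definition _ := Measure_isSigmaFinite.Build _ _ _
  (cons_measure mu nu) cons_measure_sigma_finite.

End instances.

(* The [n]-fold product measure of [mu]. *)
Fixpoint tuple_measure (mu : {sigma_finite_measure set T -> \bar R}) n :
    {sigma_finite_measure set (n.-tuple T) -> \bar R} :=
  match n with
  | 0%N => @dirac _ (0.-tuple T) [tuple] R
  | m.+1 => cons_measure mu (tuple_measure mu m)
  end.

Lemma tuple_measure_box (mu : {sigma_finite_measure set T -> \bar R}) n
    (A : 'I_n -> set T) : (forall i, measurable (A i)) ->
  tuple_measure mu n [set t | forall i, A i (tnth t i)] = \prod_(i < n) mu (A i).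
Proof.
elim: n A => [|n IH] A mA.
  by rewrite big_ord0 /= diracE mem_set// => -[].
rewrite big_ord_recl -IH//= /cons_measure /pushforward.
rewrite [X in (mu \x _) X](_ : _ = A ord0 `*`
    [set t | forall i, A (lift ord0 i) (tnth t i)]); last first.
  apply/seteqP; split=> -[x t] /=.
    move=> At; split; first exact: (At ord0).
    by move=> i; move: (At (lift ord0 i)); rewrite tnthS.
  by move=> [Ax At] i; case: (unliftP ord0 i) => [j ->|->//]; rewrite tnthS.
rewrite product_measure1E//.
rewrite [X in measurable X](_ : _ = \bigcap_(i in setT)
    (fun t : n.-tuple T => tnth t i) @^-1` A (lift ord0 i)); last first.
  by apply/seteqP; split=> t /= At i; [move=> _; exact: At|exact: (At i)].
apply: fin_bigcap_measurable => // i _.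
by rewrite -[X in measurable X]setTI; exact: measurable_tnth.
Qed.

End tuple_measure.

Section hard_spheres.
Context (R : realType).
Local Notation Rd d := (d.-tuple (measurableTypeR R)).

Definition lebesgue_Rd d : {sigma_finite_measure set (Rd d) -> \bar R} :=
  tuple_measure (@lebesgue_measure R) d.

Definition edist d (x y : Rd d) : R :=
  Num.sqrt (\sum_(i < d) (tnth x i - tnth y i) ^+ 2).

Definition eball d (x : Rd d) (r : R) : set (Rd d) := [set y | edist x y <= r].

Definition origin d : Rd d := [tuple 0 | _ < d].

(* The ball of radius [r] has volume [r ^+ d] times that of the unit ball, so
   for [0 < d] exactly one [r] satisfies the condition; [xget] returns it. *)
Definition unit_volume_radius d : R :=
  xget 0 [set r | 0 <= r /\ lebesgue_Rd d (eball (origin d) r) = 1%E].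

Definition hard_core d k : set (k.-tuple (Rd d)) :=
  [set x | forall i j : 'I_k, i != j ->
    2 * unit_volume_radius d < edist (tnth x i) (tnth x j)].

Definition Zhat d (S : set (Rd d)) k : \bar R :=
  if k is 0 then 1%E
  else ((k`!%:R^-1)%:E *
        \int[tuple_measure (lebesgue_Rd d) k]_(x in
          [set x : k.-tuple (Rd d) | forall i, S (tnth x i)])
          (\1_(@hard_core d k) x)%:E)%E.

Definition Zpart d (S : set (Rd d)) (lambda : R) : \bar R :=
  (\sum_(0 <= k <oo) (lambda ^+ k)%:E * Zhat S k)%E.

Definition volume_ball d n : set (Rd d) :=
  eball (origin d) (n%:R `^ d%:R^-1 * unit_volume_radius d).

(* [lne] and the limit are taken in [\bar R]; all the values are finite. *)
Definition pressure d (lambda : R) : \bar R :=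
  limn (fun n => (n%:R^-1)%:E * lne (Zpart (@volume_ball d n) lambda))%E.

End hard_spheres.

(* Main.v *)
(** A hard-core gas on a set S is compared with the gas seen from a point v:
    outside the ball B(v) of radius 2 r_d around v its configuration Y leaves a
    free set T inside B(v), on which the gas is again a hard-core gas.  If |T|
    is small in the mean, then v is often uncovered.  If |T| is large, then B(v)
    contains many centers, because a point of T has, on average over T, a volume
    of at most 2 * 3^(d/2) of T within distance 2 r_d.  Every center lies in the
    balls B(v) of a set of v of volume 2^d, so averaging over v in S bounds the
    mean number of centers below by about (log 2 - s) d |S| / 2^d at fugacity
    e^(-sd), for every S of finite volume, without boundary terms.  Jensen's
    inequality turns this into increments of log Z along a grid of fugacities
    from e^(-(log 2) d) up to e^(-cd), and the increments add up to
    (log 2 - c)^2 d^2 |S| / 2^(d+1).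

    The conditioning on Y is expressed by the insertion operators J W ("add one
    center in W") on set functionals: they are positive, commute, and satisfy
    J setT = J W + J (~` W), so the partition function exp(lam J setT) 1 factors
    as exp(lam J W) (exp(lam J (~` W)) 1).  The same factorization makes log Z
    subadditive, and additive for distant sets, so that tiling balls by cubes
    shows that the limit defining the pressure exists. *)
Require Import Defs.
From mathcomp Require Import all_boot all_order all_algebra.
From mathcomp Require Import all_classical all_reals all_analysis.
From mathcomp Require Import measurable_realfun lra ring.

Import Order.TTheory GRing.Theory Num.Theory.
Import numFieldNormedType.Exports.

Local Open Scope classical_set_scope.
Local Open Scope ring_scope.

Set Implicit Arguments.
Unset Strict Implicit.
Unset Printing Implicit Defensive.

(** * Rearrangement of double series *)

Section series.
Context (R : realType).
Local Open Scope ereal_scope.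

(** Tonelli for series, applied to the array [c] that shifts row [i] of [b] by [i] places and pads
    it with zeros, so that antidiagonals become columns. *)
Lemma nneseries_cauchy (b : nat -> nat -> \bar R) : (forall i j, 0 <= b i j) ->
  \sum_(0 <= k <oo) \sum_(i < k.+1) b i (k - i)%N =
  \sum_(0 <= i <oo) \sum_(0 <= j <oo) b i j.
Proof.
move=> b0.
pose c i k := if (i <= k)%N then b i (k - i)%N else 0.
have c0 i k : 0 <= c i k by rewrite /c; case: ifP.
transitivity (\sum_(0 <= k <oo) \sum_(0 <= i <oo) c i k).
  apply: eq_eseriesr => k _.
  rewrite (nneseries_split 0 k.+1)// add0n [X in _ + X]eseries0 ?adde0; last first.
    by move=> i ki _; rewrite /c leqNgt ki.
  rewrite big_mkord; apply: eq_bigr => i _.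
  by rewrite /c -ltnS ltn_ord.
rewrite nneseries_interchange//; apply: eq_eseriesr => i _.
rewrite (nneseries_split 0 i)// add0n big1_seq ?add0e; last first.
  by move=> k /=; rewrite mem_index_iota /= => ki; rewrite /c leqNgt ki.
rewrite -nneseries_addn//; apply: eq_eseriesr => j _.
by rewrite /c leq_addl addnK.
Qed.

End series.

(** * Insertion operators on set functionals *)

Section hard_core_operators.
Context (d : measure_display) (X : measurableType d) (R : realType).
Variable mu : {sigma_finite_measure set X -> \bar R}.
Variable C : set (X * X).
Hypothesis mC : measurable C.
Hypothesis symC : forall x y, C (x, y) -> C (y, x).
Local Open Scope ereal_scope.

Implicit Types (S W V : set X) (F : set X -> \bar R).

Definition slice (T : Type) (E : set (T * X)) (t : T) : set X := [set x | E (t, x)].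

Lemma measurable_slice d' (P : measurableType d') (E : set (P * X)) p :
  measurable E -> measurable (slice E p).
Proof.
move=> mE; have := measurable_xsection p mE.
by congr measurable; apply/seteqP; split=> x; rewrite /xsection/= inE.
Qed.

(** A pair in [C] is a pair of centers that may coexist, so this is the part of [S] still free once
    a center sits at [u]. *)
Definition excl S u : set X := S `&` slice C u.

Lemma measurable_excl S u : measurable S -> measurable (excl S u).
Proof. by move=> mS; apply: measurableI => //; exact: measurable_slice. Qed.

Lemma excl_sub S u : excl S u `<=` S. Proof. by move=> x []. Qed.

Lemma exclC S u v : excl (excl S u) v = excl (excl S v) u.
Proof. by rewrite /excl setIAC. Qed.

Lemma exclI S W u : excl (S `&` W) u = excl S u `&` W.
Proof. by rewrite /excl setIAC. Qed.

(* There being no sigma-algebra on sets, measurability of a set functional is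
   required along measurable families of sets. *)
Definition mfunctional F := (forall S, 0 <= F S) /\
  forall d' (P : measurableType d') (E : set (P * X)), measurable E ->
    measurable_fun setT (fun p => F (slice E p)).

Lemma mfunctional_ge0 F S : mfunctional F -> 0 <= F S. Proof. by case. Qed.

(** The state of the gas is carried by its free set alone: a center placed at [u] leaves [excl S u]
    as the domain of everything placed later. *)
Definition insertion W F S := \int[mu]_(u in S `&` W) F (excl S u).

Local Notation J := insertion.

(** The free sets left by one more center form a measurable family over the enlarged parameter space
    [P * X]. Since each insertion adds a variable in this way, [mfunctional] has to quantify over
    all parameter spaces. *)
Lemma measurable_excl_slice d' (P : measurableType d') (E : set (P * X)) :
  measurable E ->
  measurable [set q : (P * X) * X | E (q.1.1, q.2) /\ C (q.1.2, q.2)].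
Proof.
move=> mE; apply: measurableI; rewrite -[X in measurable X]setTI.
- have mf : measurable_fun setT (fun q : (P * X) * X => (q.1.1, q.2)).
    by apply: measurable_fun_pair; [exact: (measurableT_comp measurable_fst measurable_fst)|exact: measurable_snd].
  exact: mf.
- have mf : measurable_fun setT (fun q : (P * X) * X => (q.1.2, q.2)).
    by apply: measurable_fun_pair; [exact: (measurableT_comp measurable_snd measurable_fst)|exact: measurable_snd].
  exact: mf.
Qed.

Lemma mfunctional_J W F : measurable W -> mfunctional F -> mfunctional (J W F).
Proof.
move=> mW [F0 mF]; split=> [S|d' P E mE]; first exact: integral_ge0.
pose E' := [set q : (P * X) * X | E (q.1.1, q.2) /\ C (q.1.2, q.2)].
have mE' : measurable E' by exact: measurable_excl_slice.
have mEW : measurable (E `&` snd @^-1` W).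
  by apply: measurableI => //; rewrite -[X in measurable X]setTI; exact: measurable_snd.
pose h := (fun q => F (slice E' q)) \_ (E `&` snd @^-1` W).
have mh : measurable_fun setT h.
  by apply/(measurable_restrictT _ _).1 => //; apply: measurable_funTS; exact: mF.
have h0 q : 0 <= h q by apply: erestrict_ge0.
have := @measurable_fun_fubini_tonelli_F _ _ _ _ _ mu h mh h0.
congr (measurable_fun _); apply/funext => p; rewrite /fubini_F /J [RHS]integral_mkcond.
apply: eq_integral => x _; rewrite /h !patchE.
by congr (if _ then _ else _); apply/idP/idP; rewrite !inE.
Qed.

Lemma measurable_mfunctional_excl F S : mfunctional F -> measurable S ->
  measurable_fun setT (fun u => F (excl S u)).
Proof.
move=> [_ mF] mS.
apply: (mF _ _ [set q : X * X | S q.2 /\ C q]).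
apply: measurableI => //; rewrite -[X in measurable X]setTI.
exact: measurable_snd.
Qed.

Lemma measurable_mfunctional_excl2 F S : mfunctional F -> measurable S ->
  measurable_fun setT (fun q => F (excl (excl S q.1) q.2)).
Proof.
move=> [_ mF] mS.
have mE : measurable [set q : X * X | S q.2 /\ C q].
  apply: measurableI => //; rewrite -[X in measurable X]setTI.
  exact: measurable_snd.
exact: (mF _ _ _ (measurable_excl_slice mE)).
Qed.

Lemma mfunctional_cst (c : R) : (0 <= c)%R -> mfunctional (fun=> c%:E).
Proof. by move=> c0; split=> // S; rewrite lee_fin. Qed.

Lemma mfunctional_scale (c : R) F : (0 <= c)%R -> mfunctional F -> mfunctional (fun S => c%:E * F S).
Proof.
move=> c0 [F0 mF]; split=> [S|d' P E mE]; first by rewrite mule_ge0.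
by apply: measurable_funeM; exact: mF.
Qed.

Lemma mfunctional_add F F' : mfunctional F -> mfunctional F' -> mfunctional (fun S => F S + F' S).
Proof.
move=> [F0 mF] [F0' mF']; split=> [S|d' P E mE]; first by rewrite adde_ge0.
by apply: emeasurable_funD; [exact: mF|exact: mF'].
Qed.

Lemma mfunctional_series (F : nat -> set X -> \bar R) :
  (forall i, mfunctional (F i)) -> mfunctional (fun S => \sum_(0 <= i <oo) F i S).
Proof.
move=> gF; split=> [S|d' P E mE].
  by apply: nneseries_ge0 => i _ _; exact: mfunctional_ge0.
apply: ge0_emeasurable_sum => [i p _ _|i _]; first exact: mfunctional_ge0.
exact: (gF i).2.
Qed.

Lemma mfunctional_restr W F : measurable W -> mfunctional F -> mfunctional (fun S => F (S `&` W)).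
Proof.
move=> mW [F0 mF]; split=> // d' P E mE.
apply: (mF _ _ (E `&` snd @^-1` W)).
by apply: measurableI => //; rewrite -[X in measurable X]setTI; exact: measurable_snd.
Qed.

Lemma mfunctional_measure : mfunctional mu.
Proof.
split=> // d' P E mE.
have := measurable_fun_xsection mu mE.
congr (measurable_fun _); apply/funext => p /=; congr (mu _).
by apply/seteqP; split=> x; rewrite /xsection/= inE.
Qed.

Section linearity.
Variables (W S : set X).
Hypotheses (mW : measurable W) (mS : measurable S).

Let mSW : measurable (S `&` W). Proof. exact: measurableI. Qed.

Let mfun F : mfunctional F -> measurable_fun (S `&` W) (fun u => F (excl S u)).
Proof. by move=> gF; apply: measurable_funTS; exact: measurable_mfunctional_excl. Qed.

Lemma J_le F F' : mfunctional F -> mfunctional F' ->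
  (forall u, S u -> W u -> F (excl S u) <= F' (excl S u)) ->
  J W F S <= J W F' S.
Proof.
move=> gF gF' h; apply: ge0_le_integral => //; [|exact: mfun|exact: mfun|].
  by move=> x _; exact: mfunctional_ge0.
by move=> x [Sx Wx]; exact: h.
Qed.

Lemma J_eq F F' : (forall u, S u -> W u -> F (excl S u) = F' (excl S u)) ->
  J W F S = J W F' S.
Proof. by move=> h; apply: eq_integral => x; rewrite inE => -[Sx Wx]; exact: h. Qed.

Lemma JD F F' : mfunctional F -> mfunctional F' ->
  J W (fun T => F T + F' T) S = J W F S + J W F' S.
Proof.
move=> gF gF'; apply: ge0_integralD => //; [|exact: mfun| |exact: mfun];
 by move=> x _; exact: mfunctional_ge0.
Qed.

Lemma JZ (c : R) F : (0 <= c)%R -> mfunctional F -> J W (fun T => c%:E * F T) S = c%:E * J W F S.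
Proof.
move=> c0 gF; apply: ge0_integralZl_EFin => //; last exact: mfun.
by move=> x _; exact: mfunctional_ge0.
Qed.

Lemma J_sum (I : Type) (s : seq I) (F : I -> set X -> \bar R) :
  (forall i, mfunctional (F i)) ->
  J W (fun T => \sum_(i <- s) F i T) S = \sum_(i <- s) J W (F i) S.
Proof.
move=> gF; apply: ge0_integral_sum => // [i|i x _]; first exact: mfun.
exact: mfunctional_ge0.
Qed.

Lemma J_series (F : nat -> set X -> \bar R) :
  (forall i, mfunctional (F i)) ->
  J W (fun T => \sum_(0 <= i <oo) F i T) S = \sum_(0 <= i <oo) J W (F i) S.
Proof.
move=> gF; apply: integral_nneseries => // [i|i x _]; first exact: mfun.
exact: mfunctional_ge0.
Qed.

Lemma J_setC F : mfunctional F -> J setT F S = J W F S + J (~` W) F S.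
Proof.
move=> gF; rewrite /J -(setUv W) setIUr ge0_integral_setU//.
- by apply: measurableI => //; exact: measurableC.
- by apply: measurable_funTS; exact: measurable_mfunctional_excl.
- by move=> x _; exact: mfunctional_ge0.
- by apply/disj_setPS => x [[_ Wx] [_ nWx]].
Qed.

End linearity.

(** Both sides integrate [F] of the doubly reduced set over compatible pairs of centers. Symmetry of
    [C] makes the order of insertion irrelevant, and Tonelli exchanges the integrals. *)
Lemma J_comm W V F S : measurable W -> measurable V -> measurable S -> mfunctional F ->
  J W (J V F) S = J V (J W F) S.
Proof.
move=> mW mV mS gF.
pose H W V := (fun q => F (excl (excl S q.1) q.2)) \_
  ((fst @^-1` (S `&` W) `&` snd @^-1` (S `&` V)) `&` C).
have HE W' V' : J W' (J V' F) S = \int[mu]_u \int[mu]_w H W' V' (u, w).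
  rewrite /J integral_mkcond; apply: eq_integral => u _; rewrite patchE.
  case: ifPn => [|/negP]; rewrite inE.
    move=> [Su Wu]; rewrite integral_mkcond; apply: eq_integral => w _.
    rewrite /H !patchE; congr (if _ then _ else _).
    apply/idP/idP; rewrite !inE /=; first by move=> [[]].
    by move=> [[_ []]].
  move=> nSW; rewrite integral0_eq// => w _; rewrite /H patchE ifF//.
  by apply/negbTE/negP; rewrite inE => -[[]].
have mH W' V' : measurable W' -> measurable V' -> measurable_fun setT (H W' V').
  move=> mW' mV'; apply/(measurable_restrictT _ _).1; last first.
    by apply: measurable_funTS; exact: measurable_mfunctional_excl2.
  apply: measurableI => //; apply: measurableI.
    by rewrite -[X in measurable X]setTI; apply: measurable_fst => //; exact: measurableI.
  by rewrite -[X in measurable X]setTI; apply: measurable_snd => //; exact: measurableI.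
have H0 q : 0 <= H W V q by apply: erestrict_ge0 => x _; exact: mfunctional_ge0.
rewrite !HE; etransitivity; first exact: (@fubini_tonelli _ _ _ _ _ mu mu _ (mH W V mW mV) H0).
apply: eq_integral => u _; apply: eq_integral => w _; rewrite /H !patchE/= exclC.
congr (if _ then _ else _); apply/idP/idP; rewrite !inE/= => -[[? ?] ?]; split => //;
 exact: symC.
Qed.

Fixpoint insertion_iter W m F : set X -> \bar R :=
  if m is j.+1 then fun S => (j.+1%:R^-1)%:E * J W (insertion_iter W j F) S else F.

Local Notation G := insertion_iter.

Lemma GS W m F S : (m.+1%:R)%:E * G W m.+1 F S = J W (G W m F) S.
Proof. by rewrite /= muleA -EFinM mulfV// mul1e. Qed.

Section iterates.
Variable W : set X.
Hypothesis mW : measurable W.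

Lemma mfunctional_G m F : mfunctional F -> mfunctional (G W m F).
Proof.
move=> gF; elim: m => //= m IH; apply: mfunctional_scale => //; exact: mfunctional_J.
Qed.

Lemma G_le m F F' S : mfunctional F -> mfunctional F' -> measurable S ->
  (forall T, measurable T -> T `<=` S -> F T <= F' T) ->
  G W m F S <= G W m F' S.
Proof.
move=> gF gF'; elim: m S => [|m IH] S mS h /=; first exact: h.
rewrite lee_pmul2l// ?lte_fin//; apply: J_le => //; [exact: mfunctional_G|exact: mfunctional_G|].
move=> u Su Wu; apply: IH; first exact: measurable_excl.
by move=> T mT TS; apply: h => //; apply: subset_trans TS (@excl_sub _ _).
Qed.

Lemma G_eq m F F' S : measurable S ->
  (forall T, measurable T -> T `<=` S -> F T = F' T) ->
  G W m F S = G W m F' S.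
Proof.
elim: m S => [|m IH] S mS h /=; first exact: h.
congr (_ * _); apply: J_eq => u Su Wu; apply: IH; first exact: measurable_excl.
by move=> T mT TS; apply: h => //; apply: subset_trans TS (@excl_sub _ _).
Qed.

Lemma GD m F F' S : mfunctional F -> mfunctional F' -> measurable S ->
  G W m (fun T => F T + F' T) S = G W m F S + G W m F' S.
Proof.
move=> gF gF'; elim: m S => [//|m IH] S mS /=.
rewrite -ge0_muleDr; [|exact/mfunctional_ge0/mfunctional_J/mfunctional_G..].
rewrite -JD//; [|exact: mfunctional_G..]; congr (_ * _); apply: J_eq => u Su Wu.
by apply: IH; exact: measurable_excl.
Qed.

Lemma GZ m (c : R) F S : (0 <= c)%R -> mfunctional F -> measurable S ->
  G W m (fun T => c%:E * F T) S = c%:E * G W m F S.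
Proof.
move=> c0 gF; elim: m S => [//|m IH] S mS /=.
rewrite muleCA -(JZ mW mS c0); last exact: mfunctional_G.
congr (_ * _); apply: J_eq => u Su Wu; apply: IH; exact: measurable_excl.
Qed.

Lemma G_series m (F : nat -> set X -> \bar R) S : (forall i, mfunctional (F i)) ->
  measurable S ->
  G W m (fun T => \sum_(0 <= i <oo) F i T) S = \sum_(0 <= i <oo) G W m (F i) S.
Proof.
move=> gF; elim: m S => [//|m IH] S mS /=.
rewrite nneseriesZl; last by move=> i _; apply/mfunctional_ge0/mfunctional_J => //; exact: mfunctional_G.
rewrite -J_series//; last by move=> i; exact: mfunctional_G.
congr (_ * _); apply: J_eq => u Su Wu; apply: IH; exact: measurable_excl.
Qed.

Lemma GJ_comm V m F S : measurable V -> mfunctional F -> measurable S ->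
  G W m (J V F) S = J V (G W m F) S.
Proof.
move=> mV gF; elim: m S => [//|m IH] S mS /=.
rewrite JZ//; last by apply: mfunctional_J => //; exact: mfunctional_G.
rewrite -J_comm//; last exact: mfunctional_G.
congr (_ * _); apply: J_eq => u Su Wu; apply: IH; exact: measurable_excl.
Qed.

End iterates.

(** The binomial theorem for commuting operators, with the factorials divided out. After
    multiplication by [k.+1], one more insertion falls in [W] or in its complement, and the term of
    index [i] collects the weights [i] and [k.+1 - i], which add up to [k.+1]. *)
Lemma G_binomial W k F S : measurable W -> mfunctional F -> measurable S ->
  G setT k F S = \sum_(i < k.+1) G W i (G (~` W) (k - i) F) S.
Proof.
move=> mW gF; have mW' := measurableC mW.
elim: k S => [|k IH] S mS; first by rewrite big_ord1.
have gT m : mfunctional (G setT m F) by exact: mfunctional_G.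
have gV m : mfunctional (G (~` W) m F) by exact: mfunctional_G.
have gW i m : mfunctional (G W i (G (~` W) m F)) by exact: mfunctional_G.
have k0 : (k.+1%:R != 0 :> R)%R by rewrite pnatr_eq0.
have fE a b : (k.+1%:R)%:E * a = (k.+1%:R)%:E * b -> a = b :> \bar R.
  move=> /(congr1 (fun x => (k.+1%:R^-1)%:E * x)).
  by rewrite !muleA -!EFinM mulVf// !mul1e.
apply: fE; rewrite GS (J_setC mW)//.
have IH' u : S u -> G setT k F (excl S u) =
    \sum_(i < k.+1) G W i (G (~` W) (k - i) F) (excl S u).
  by move=> Su; apply: IH; exact: measurable_excl.
rewrite (@J_eq _ _ _ (fun T => \sum_(i < k.+1) G W i (G (~` W) (k - i) F) T)); last first.
  by move=> u Su _; exact: IH'.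
rewrite (@J_eq (~` W) _ _ (fun T => \sum_(i < k.+1) G W i (G (~` W) (k - i) F) T)); last first.
  by move=> u Su _; exact: IH'.
rewrite !J_sum//.
(* An insertion in [W] shifts the index by one; the added term [i = 0] has weight zero. *)
have -> : \sum_(i < k.+1) J W (G W i (G (~` W) (k - i) F)) S =
   \sum_(i < k.+2) (i%:R)%:E * G W i (G (~` W) (k.+1 - i) F) S.
  rewrite [RHS]big_ord_recl mul0e add0e; apply: eq_bigr => i _.
  by rewrite -GS /= subSS.
(* Commutation moves the insertion past the outer iterate onto the inner one, whose degree it
   raises; the added last term has weight zero. *)
have -> : \sum_(i < k.+1) J (~` W) (G W i (G (~` W) (k - i) F)) S =
   \sum_(i < k.+2) ((k.+1 - i)%:R)%:E * G W i (G (~` W) (k.+1 - i) F) S.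
  rewrite [RHS]big_ord_recr/= subnn mul0e adde0; apply: eq_bigr => i _.
  have -> : (k.+1 - i = (k - i).+1)%N by rewrite subSn// -ltnS.
  rewrite -(GJ_comm mW _ mW' (gV _) mS) -(GZ mW _ _ (gV _) mS)//.
  by apply: G_eq => // T mT _; rewrite GS.
rewrite -big_split /= ge0_sume_distrr; last by move=> i _; exact: mfunctional_ge0.
apply: eq_bigr => i _; rewrite -ge0_muleDl ?lee_fin//; congr (_ * _).
by rewrite -EFinD -natrD subnKC// -ltnS.
Qed.

End hard_core_operators.

(** * Partition functions and the mean number of centers *)

Section partition_function.
Context (d : measure_display) (X : measurableType d) (R : realType).
Variable mu : {sigma_finite_measure set X -> \bar R}.
Variable C : set (X * X).
Hypothesis mC : measurable C.
Hypothesis symC : forall x y, C (x, y) -> C (y, x).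
Local Open Scope ereal_scope.
Local Notation J := (insertion mu C).
Local Notation G := (insertion_iter mu C).
Local Notation excl := (excl C).

Implicit Types (S W V T : set X) (F : set X -> \bar R) (lam : R).

(** The abstract counterpart of [Zhat]; the resulting partition functions are identified in
    [Zpart_Z]. *)
Definition conf k S := G setT k (fun=> 1) S.

Definition Z lam S := \sum_(0 <= k <oo) (lam ^+ k)%:E * conf k S.

Let mu_sub S T : measurable S -> measurable T -> T `<=` S -> mu T <= mu S.
Proof. by move=> mS mT TS; apply: le_measure; rewrite ?inE. Qed.

Let good1 : mfunctional (fun _ : set X => 1 : \bar R).
Proof. exact: (mfunctional_cst _ ler01). Qed.

Lemma mfunctional_conf k : mfunctional (conf k).
Proof. exact: mfunctional_G. Qed.

Lemma conf_ge0 k S : 0 <= conf k S.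
Proof. exact/mfunctional_ge0/mfunctional_conf. Qed.

Lemma mfunctional_Z lam : (0 <= lam)%R -> mfunctional (Z lam).
Proof.
move=> l0; apply: mfunctional_series => k; apply: mfunctional_scale; rewrite ?exprn_ge0//.
exact: mfunctional_conf.
Qed.

Lemma J_restr W F S : J W (fun T => F (T `&` W)) S = J setT F (S `&` W).
Proof.
rewrite /insertion setIT; apply: eq_integral => u _.
by rewrite exclI.
Qed.

Lemma G_restr W k S : G W k (fun=> 1) S = conf k (S `&` W).
Proof.
elim: k S => [//|k IH] S; rewrite /conf/=; congr (_ * _).
rewrite -[RHS]J_restr; apply: eq_integral => u _; exact: IH.
Qed.

Section exponential.
Variable lam : R.
Hypothesis lam0 : (0 <= lam)%R.

(* [G W k] carries the factor 1/k!, so this is the operator exp(lam J W). *)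
Definition expJ W F S := \sum_(0 <= k <oo) (lam ^+ k)%:E * G W k F S.

Lemma expJ1 W S : expJ W (fun=> 1) S = Z lam (S `&` W).
Proof. by apply: eq_eseriesr => k _; rewrite G_restr. Qed.

Let term_ge0 W k F S : measurable W -> mfunctional F -> 0 <= (lam ^+ k)%:E * G W k F S.
Proof.
move=> mW gF; rewrite mule_ge0 ?lee_fin ?exprn_ge0//.
exact/mfunctional_ge0/mfunctional_G.
Qed.

Section linear.
Variables (W S : set X).
Hypotheses (mW : measurable W) (mS : measurable S).

Lemma expJ_le F F' : mfunctional F -> mfunctional F' ->
  (forall T, measurable T -> T `<=` S -> F T <= F' T) ->
  expJ W F S <= expJ W F' S.
Proof.
move=> gF gF' h; apply: lee_nneseries => k _ ; first by move=> _; exact: term_ge0.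
by rewrite lee_wpmul2l// ?lee_fin ?exprn_ge0//; exact: G_le.
Qed.

Lemma expJD F F' : mfunctional F -> mfunctional F' ->
  expJ W (fun T => F T + F' T) S = expJ W F S + expJ W F' S.
Proof.
move=> gF gF'; rewrite -nneseriesD; [|by move=> k _ _; exact: term_ge0..].
apply: eq_eseriesr => k _; rewrite -ge0_muleDr; [|exact/mfunctional_ge0/mfunctional_G..].
by congr (_ * _); exact: GD.
Qed.

Lemma expJZ (c : R) F : (0 <= c)%R -> mfunctional F ->
  expJ W (fun T => c%:E * F T) S = c%:E * expJ W F S.
Proof.
move=> c0 gF; rewrite -nneseriesZl; last by move=> k _; exact: term_ge0.
by apply: eq_eseriesr => k _; rewrite muleCA; congr (_ * _); exact: GZ.
Qed.

Lemma expJ_J V F : measurable V -> mfunctional F ->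
  expJ W (J V F) S = J V (expJ W F) S.
Proof.
move=> mV gF; rewrite J_series//; last first.
  by move=> k; apply: mfunctional_scale; rewrite ?exprn_ge0//; exact: mfunctional_G.
apply: eq_eseriesr => k _; rewrite JZ ?exprn_ge0//; last exact: mfunctional_G.
by congr (_ * _); exact: GJ_comm.
Qed.

End linear.

(** The conditioning step: [T] runs over the free sets left by the centers in [W], and the rest of
    the gas is a gas on [T] outside [W]. It is the exponential of a sum of commuting operators, that
    is, [G_binomial] summed along antidiagonals. *)
Lemma Z_split W S : measurable W -> measurable S ->
  Z lam S = expJ W (fun T => Z lam (T `&` ~` W)) S.
Proof.
move=> mW mS; have mW' := measurableC mW.
pose b i j := (lam ^+ (i + j))%:E * G W i (G (~` W) j (fun=> 1)) S.
have gW' j : mfunctional (G (~` W) j (fun=> 1)) by exact: mfunctional_G.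
have b0 i j : 0 <= b i j.
  by rewrite mule_ge0 ?lee_fin ?exprn_ge0//; apply: mfunctional_ge0; exact: mfunctional_G.
transitivity (\sum_(0 <= k <oo) \sum_(i < k.+1) b i (k - i)%N).
  apply: eq_eseriesr => k _; rewrite /conf (G_binomial mu mC symC k mW)//.
  rewrite ge0_sume_distrr; last by move=> i _; apply: mfunctional_ge0; exact: mfunctional_G.
  by apply: eq_bigr => i _; rewrite /b subnKC// -ltnS.
rewrite nneseries_cauchy//; apply: eq_eseriesr => i _.
rewrite (@G_eq _ _ _ mu C mC W i _ (fun T => \sum_(0 <= j <oo)
   (lam ^+ j)%:E * G (~` W) j (fun=> 1) T))//; last first.
  by move=> T mT _; rewrite -[LHS]expJ1.
rewrite G_series//; last by move=> j; apply: mfunctional_scale; rewrite ?exprn_ge0.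
rewrite -nneseriesZl; last first.
  move=> j _; apply: mfunctional_ge0; apply: mfunctional_G => //.
  by apply: mfunctional_scale; rewrite ?exprn_ge0.
apply: eq_eseriesr => j _; rewrite /b exprD EFinM -muleA; congr (_ * _).
by rewrite -GZ ?exprn_ge0.
Qed.

End exponential.

Lemma J_subset F S T : mfunctional F -> measurable S -> measurable T -> T `<=` S ->
  (forall u, T u -> F (excl T u) <= F (excl S u)) ->
  J setT F T <= J setT F S.
Proof.
move=> gF mS mT TS h; rewrite /insertion !setIT.
apply: (@le_trans _ _ (\int[mu]_(u in T) F (excl S u))).
  apply: ge0_le_integral => //.
  - by move=> u _; exact: mfunctional_ge0.
  - by apply: measurable_funTS; exact: measurable_mfunctional_excl.
  - by apply: measurable_funTS; exact: measurable_mfunctional_excl.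
apply: ge0_subset_integral => //.
- by apply: measurable_funTS; exact: measurable_mfunctional_excl.
- by move=> u _; exact: mfunctional_ge0.
Qed.

Lemma confS k S : (k.+1%:R)%:E * conf k.+1 S = J setT (conf k) S.
Proof. exact: GS. Qed.

Lemma lee_pmulSl k (x y : \bar R) :
  (k.+1%:R)%:E * x <= (k.+1%:R)%:E * y -> x <= y.
Proof. by rewrite lee_pmul2l// lte_fin. Qed.

Lemma conf_sub k S T : measurable S -> measurable T -> T `<=` S ->
  conf k T <= conf k S.
Proof.
elim: k S T => [//|k IH] S T mS mT TS.
apply: (@lee_pmulSl k); rewrite !confS; apply: J_subset => // [|u Tu].
  exact: mfunctional_conf.
apply: IH; [exact: measurable_excl|exact: measurable_excl|exact: setSI].
Qed.

Lemma Z_sub lam S T : (0 <= lam)%R -> measurable S -> measurable T -> T `<=` S ->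
  Z lam T <= Z lam S.
Proof.
move=> l0 mS mT TS; apply: lee_nneseries => k _ .
  by move=> _; rewrite mule_ge0 ?conf_ge0 ?lee_fin ?exprn_ge0.
by rewrite lee_wpmul2l ?lee_fin ?exprn_ge0//; exact: conf_sub.
Qed.

Lemma J_cst W S (c : \bar R) : measurable W -> measurable S ->
  J W (fun=> c) S = c * mu (S `&` W).
Proof. by move=> mW mS; rewrite /insertion integral_cst//; exact: measurableI. Qed.

(** Dropping the exclusion leaves [k] unordered independent points in a set of volume at most
    [v]. *)
Lemma conf_le k S (v : R) : measurable S -> mu S <= v%:E ->
  conf k S <= (v ^+ k / k`!%:R)%:E.
Proof.
elim: k S => [|k IH] S mS Sv; first by rewrite expr0 fact0 divr1.
have v0 : (0 <= v)%R by rewrite -lee_fin (le_trans _ Sv).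
have f0 : (0 <= v ^+ k / k`!%:R)%R by rewrite divr_ge0 ?exprn_ge0.
apply: (@lee_pmulSl k); rewrite confS.
apply: (@le_trans _ _ (J setT (fun=> (v ^+ k / k`!%:R)%:E) S)).
  apply: J_le => //; [exact: mfunctional_conf|].
  move=> u Su _; apply: IH; first exact: measurable_excl.
  by apply: le_trans Sv; apply: mu_sub => //; [exact: measurable_excl|exact: excl_sub].
rewrite J_cst// setIT; apply: (@le_trans _ _ ((v ^+ k / k`!%:R)%:E * v%:E)).
  by rewrite lee_wpmul2l.
rewrite -!EFinM lee_fin factS natrM exprSr.
have k1 : (k.+1%:R != 0 :> R)%R by rewrite pnatr_eq0.
have k2 : (k`!%:R != 0 :> R)%R by rewrite pnatr_eq0 -lt0n fact_gt0.
rewrite le_eqVlt; apply/orP; left; apply/eqP.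
move: k1 k2; move: (k.+1%:R)%R (k`!%:R)%R => a b a0 b0.
by field; rewrite a0 b0.
Qed.

Lemma nneseries_expR (x : R) :
  \sum_(0 <= k <oo) (x ^+ k / k`!%:R)%:E = (expR x)%:E.
Proof.
rewrite /expR -EFin_lim; last exact: is_cvg_series_exp_coeff.
by apply/congr_lim/funext => n /=; rewrite -sumEFin.
Qed.

Lemma Z_le_expR lam S (v : R) : (0 <= lam)%R -> measurable S -> mu S <= v%:E ->
  Z lam S <= (expR (lam * v))%:E.
Proof.
move=> l0 mS Sv; rewrite -nneseries_expR; apply: lee_nneseries => k _.
  by move=> _; rewrite mule_ge0 ?conf_ge0 ?lee_fin ?exprn_ge0.
rewrite exprMn -mulrA [leRHS]EFinM lee_wpmul2l ?lee_fin ?exprn_ge0//.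
exact: conf_le.
Qed.

Lemma Z_ge1 lam S : (0 <= lam)%R -> 1 <= Z lam S.
Proof.
move=> l0; rewrite /Z (nneseries_split 0 1); last first.
  by move=> k _; rewrite mule_ge0 ?conf_ge0 ?lee_fin ?exprn_ge0.
rewrite add0n big_nat1 expr0 mul1e; apply: leeDl; apply: nneseries_ge0 => k _ _.
by rewrite mule_ge0 ?conf_ge0 ?lee_fin ?exprn_ge0.
Qed.

(** A configuration of [k] centers either stays in [W] or has a center in [S] outside [W]. That
    center ranges over a volume of at most [w], and the others form a configuration of [k - 1]
    centers in [S]. *)
Lemma conf_union k W S (w : R) : measurable W -> measurable S ->
  mu (S `&` ~` W) <= w%:E ->
  conf k S <= conf k (S `&` W) + w%:E * (if k is j.+1 then conf j S else 0).
Proof.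
move=> mW; have mW' := measurableC mW.
elim: k S => [|k IH] S mS Sw; first by rewrite mule0 adde0.
have w0 : (0 <= w)%R by rewrite -lee_fin (le_trans _ Sw).
pose conf' k S := if k is j.+1 then conf j S else 0%R : \bar R.
have gconf' j : mfunctional (conf' j).
  by case: j => [|j]; [exact: mfunctional_cst (lexx _)|exact: mfunctional_conf].
have gW : mfunctional (fun T => conf k (T `&` W)) by apply: mfunctional_restr => //; exact: mfunctional_conf.
apply: (@lee_pmulSl k); rewrite ge0_muleDr; [|exact: conf_ge0|by rewrite mule_ge0 ?conf_ge0].
rewrite !confS.
rewrite (J_setC mu mC mW)//; last exact: mfunctional_conf.
have H1 : J W (conf k) S <= J setT (conf k) (S `&` W) + w%:E * J setT (conf' k) S.
  apply: (@le_trans _ _ (J W (fun T => conf k (T `&` W) + w%:E * conf' k T) S)).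
    apply: J_le => //; first exact: mfunctional_conf.
      by apply: mfunctional_add => //; exact: mfunctional_scale.
    move=> u Su _; apply: IH; first exact: measurable_excl.
    apply: le_trans Sw; apply: mu_sub; [exact: measurableI| |].
      by apply: measurableI => //; exact: measurable_excl.
    by apply: setSI; exact: excl_sub.
  rewrite JD//; last exact: mfunctional_scale.
  rewrite J_restr JZ//; apply: leeD => //; rewrite lee_wpmul2l//.
  rewrite (J_setC mu mC mW mS)//; apply: leeDl.
  by apply: mfunctional_ge0; exact: mfunctional_J.
have H2 : J (~` W) (conf k) S <= w%:E * conf k S.
  apply: (@le_trans _ _ (conf k S * mu (S `&` ~` W))); last first.
    by rewrite muleC lee_wpmul2r ?conf_ge0.
  rewrite -J_cst// /insertion; apply: ge0_le_integral => //; first exact: measurableI.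
  - by move=> u _; exact: conf_ge0.
  - by apply: measurable_funTS; apply: measurable_mfunctional_excl => //; exact: mfunctional_conf.
  - by move=> u _; apply: conf_sub => //; [exact: measurable_excl|exact: excl_sub].
apply: (le_trans (leeD H1 H2)); rewrite -addeA leeD2l// muleCA -ge0_muleDr ?conf_ge0//.
  (* The factor [k.+1] splits as [k] plus 1: the recursive term gives [k] copies of [conf k S]
     through [confS], and the centers outside [W] give one more. *)
  rewrite lee_wpmul2l//; case: k {IH gW H1 H2 gconf'} => [|k].
    by rewrite /conf' J_cst// mul0e add0e mul1e.
  rewrite -confS -[X in _ + X]mul1e -ge0_muleDl ?lee_fin//.
  by rewrite -EFinD natr1.
by apply: mfunctional_ge0; exact: mfunctional_J.
Qed.

(** In terms of the gas on [S]: some center lies outside [W] with probability at most [lam * w]. *)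
Lemma Z_union lam W S (w : R) : (0 <= lam)%R -> measurable W -> measurable S ->
  mu (S `&` ~` W) <= w%:E ->
  Z lam S <= Z lam (S `&` W) + (lam * w)%:E * Z lam S.
Proof.
move=> l0 mW mS Sw; have w0 : (0 <= w)%R by rewrite -lee_fin (le_trans _ Sw).
have term0 k T : 0 <= (lam ^+ k)%:E * conf k T.
  by rewrite mule_ge0 ?conf_ge0 ?lee_fin ?exprn_ge0.
pose r k := w%:E * (if k is j.+1 then (lam ^+ k)%:E * conf j S else 0).
have r0 k : 0 <= r k.
  by rewrite mule_ge0//; case: k => // k; rewrite mule_ge0 ?conf_ge0 ?lee_fin ?exprn_ge0.
apply: (@le_trans _ _ (\sum_(0 <= k <oo) ((lam ^+ k)%:E * conf k (S `&` W) + r k))).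
  apply: lee_nneseries => // k _; rewrite /r.
  apply: (@le_trans _ _ ((lam ^+ k)%:E * (conf k (S `&` W) +
     w%:E * (if k is j.+1 then conf j S else 0)))).
    by rewrite lee_wpmul2l ?lee_fin ?exprn_ge0//; exact: conf_union.
  rewrite ge0_muleDr ?conf_ge0//; last by case: k => *; rewrite ?mule0// mule_ge0 ?conf_ge0.
  by case: k => [|k]; [rewrite !mule0|rewrite (muleCA _ w%:E)].
rewrite nneseriesD//; apply: leeD => //.
rewrite (nneseries_split 0 1)// add0n big_nat1 {1}/r mule0 add0e.
rewrite -nneseries_addn// -nneseriesZl//; apply: lee_nneseries => [k _ _|k _].
  exact: r0.
by rewrite addn1 /r exprS !EFinM !muleA (muleC w%:E).
Qed.

(** Divided by [Z lam S], the series is the mean number of centers at fugacity [lam]. This justifies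
    reading [lam * J setT (Z lam) S] as an unnormalized mean from here on. *)
Lemma J_Z_series lam S : (0 <= lam)%R -> measurable S ->
  lam%:E * J setT (Z lam) S =
  \sum_(0 <= k <oo) (k%:R * lam ^+ k)%:E * conf k S.
Proof.
move=> l0 mS; rewrite J_series//; last first.
  by move=> k; apply: mfunctional_scale; rewrite ?exprn_ge0//; exact: mfunctional_conf.
have t0 k : 0 <= (k%:R * lam ^+ k)%:E * conf k S.
  by rewrite mule_ge0 ?conf_ge0 ?lee_fin ?mulr_ge0 ?exprn_ge0.
rewrite [RHS](nneseries_split 0 1)// add0n big_nat1 !mul0r mul0e add0e.
rewrite -nneseries_addn// -nneseriesZl; last first.
  move=> k _; apply: mfunctional_ge0; apply: mfunctional_J => //.
  by apply: mfunctional_scale; rewrite ?exprn_ge0//; exact: mfunctional_conf.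
apply: eq_eseriesr => k _; rewrite JZ ?exprn_ge0//; last exact: mfunctional_conf.
by rewrite -confS addn1 exprS !muleA -!EFinM; congr (_%:E * _); ring.
Qed.

(* Jensen: Z lam' / Z lam is the mean of (lam' / lam) ^ |X| at fugacity lam. *)
Lemma Z_jensen lam (h m : R) S : (0 <= lam)%R -> (0 <= h)%R -> (0 <= m)%R ->
  measurable S -> Z lam S < +oo ->
  m%:E * Z lam S <= lam%:E * J setT (Z lam) S ->
  (expR (h * m))%:E * Z lam S <= Z (expR h * lam) S.
Proof.
move=> l0 h0 m0 mS Zoo; rewrite J_Z_series// => mN.
set x := expR (h * m).
have x0 : (0 <= x)%R by exact: expR_ge0.
have Zfin : Z lam S \is a fin_num by rewrite ge0_fin_numE// (le_trans _ (Z_ge1 _ l0)).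
(* The tangent of [expR] at [h * m], evaluated at [h * k]. Summing it with the weights
   [lam ^+ k * conf k S] avoids normalizing to a probability measure. *)
have key k : (x * lam ^+ k + x * h * (k%:R * lam ^+ k) <=
    (expR h * lam) ^+ k + x * m * h * lam ^+ k)%R.
  rewrite exprMn -expRM_natl.
  have -> : (k%:R * h = h * m + h * (k%:R - m))%R by ring.
  rewrite expRD -/x.
  have := @expR_ge1Dx R (h * (k%:R - m)).
  move=> /(ler_wpM2l (mulr_ge0 x0 (exprn_ge0 k l0))); lra.
have c0 k : 0 <= conf k S by exact: conf_ge0.
have sum : x%:E * Z lam S + (x * h)%:E * (\sum_(0 <= k <oo) (k%:R * lam ^+ k)%:E * conf k S)
   <= Z (expR h * lam) S + (x * m * h)%:E * Z lam S.
  have l0' := exprn_ge0 _ l0.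
  have el0' k : (0 <= (expR h * lam) ^+ k)%R by rewrite exprn_ge0 ?mulr_ge0 ?expR_ge0.
  have e1 k : 0 <= (lam ^+ k)%:E * conf k S by rewrite mule_ge0// lee_fin.
  have e2 k : 0 <= (k%:R * lam ^+ k)%:E * conf k S by rewrite mule_ge0// lee_fin mulr_ge0.
  have e3 k : 0 <= ((expR h * lam) ^+ k)%:E * conf k S by rewrite mule_ge0// lee_fin.
  have xh0 : (0 <= x * h)%R by rewrite mulr_ge0.
  have xmh0 : (0 <= x * m * h)%R by rewrite !mulr_ge0.
  rewrite /Z -!nneseriesZl// -!nneseriesD//; [|by move=> k _ _; rewrite mule_ge0..].
  apply: lee_nneseries => [k _ _|k _].
    by rewrite adde_ge0// !mule_ge0// lee_fin ?mulr_ge0.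
  rewrite !muleA -!EFinM -!ge0_muleDl ?lee_fin ?mulr_ge0//.
  by rewrite lee_wpmul2r// -!EFinD lee_fin; exact: key.
have : x%:E * Z lam S + (x * m * h)%:E * Z lam S <=
       Z (expR h * lam) S + (x * m * h)%:E * Z lam S.
  apply: le_trans sum; rewrite leeD2l// mulrAC EFinM -muleA lee_wpmul2l//.
  by rewrite lee_fin mulr_ge0.
by rewrite leeD2rE// fin_numM.
Qed.

(** * A lower bound on the mean number of centers *)

Section mean_number.
Variables (lam K M kap z : R) (S : set X).
Hypotheses (lamp : (0 < lam)%R) (K0 : (0 <= K)%R) (M0 : (0 <= M)%R).
Hypotheses (kap0 : (0 <= kap)%R) (kapK : (kap * (1 - lam * K) = 1)%R).
Hypothesis z0 : (0 <= z)%R.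
Hypotheses (mS : measurable S) (Soo : mu S < +oo).

Let lam0 := ltW lamp.

Let blocked u := ~` slice C u.

Let mblocked u : measurable (blocked u).
Proof. by apply: measurableC; exact: measurable_slice. Qed.

Hypothesis SM : forall u, mu (blocked u) <= M%:E.
Hypothesis SK : forall v T, measurable T -> T `<=` blocked v -> mu T < +oo ->
  \int[mu]_(u in T) mu (T `&` blocked u) <= K%:E * mu T.

Let gZ : mfunctional (Z lam). Proof. exact: mfunctional_Z. Qed.

(** [Z_union] is integrated over [u] in [T], with [W] the points compatible with [u]. By [SK] the
    total loss is at most a fraction [lam * K] of the left side, and [kap], the inverse of
    [1 - lam * K], absorbs it. Inside one blocked ball the gas is thus nearly ideal. *)
Lemma local_mean v T : measurable T -> T `<=` blocked v -> mu T < +oo ->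
  lam%:E * mu T * Z lam T <= kap%:E * (lam%:E * J setT (Z lam) T).
Proof.
move=> mT Tv Too.
have Tfin : mu T \is a fin_num by rewrite ge0_fin_numE.
pose t := fine (mu T); have tE : mu T = t%:E by rewrite fineK.
have t0 : (0 <= t)%R by rewrite -lee_fin -tE.
have Zfin : Z lam T \is a fin_num.
  rewrite ge0_fin_numE; last exact: mfunctional_ge0.
  by rewrite (le_lt_trans (Z_le_expR lam0 mT (_ : _ <= t%:E))) ?ltry// tE.
pose q := fine (Z lam T); have qE : Z lam T = q%:E by rewrite fineK.
have q0 : (0 <= q)%R by rewrite -lee_fin -qE; exact: mfunctional_ge0.
have mB : measurable_fun T (fun u => mu (T `&` blocked u)).
  apply: measurable_funTS; have /= := (mfunctional_measure mu).2 _ _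
    [set p : X * X | T p.2 /\ ~ C p]; apply.
  apply: measurableI; last exact: measurableC.
  by rewrite -[X in measurable X]setTI; exact: measurable_snd.
have int_le : t%:E * q%:E <= J setT (Z lam) T + (lam * q)%:E * (K%:E * t%:E).
  have le1 u : T u -> Z lam T <= Z lam (excl T u) + (lam * q)%:E * mu (T `&` blocked u).
    move=> Tu.
    have bfin : mu (T `&` blocked u) \is a fin_num.
      rewrite ge0_fin_numE// (le_lt_trans _ Too)//; apply: mu_sub => //.
      exact: measurableI.
    have bE := esym (fineK bfin).
    have := @Z_union lam (slice C u) T (fine (mu (T `&` blocked u))) lam0 (measurable_slice _ mC) mT.
    by rewrite -bE => /(_ (lexx _)); move=> H; apply: (le_trans H); rewrite [mu _]bE qE -!EFinM mulrAC.
  apply: (@le_trans _ _ (J setT (Z lam) T +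
      (lam * q)%:E * \int[mu]_(u in T) mu (T `&` blocked u))); last first.
    rewrite leeD2l// lee_wpmul2l ?lee_fin ?mulr_ge0//.
    by rewrite -tE; exact: SK Tv Too.
  rewrite -ge0_integralZl_EFin ?mulr_ge0//.
  rewrite /insertion setIT -ge0_integralD//; first last.
  - by apply: measurable_funeM.
  - by move=> u _; rewrite mule_ge0 ?lee_fin ?mulr_ge0.
  - by apply: measurable_funTS; exact: measurable_mfunctional_excl.
  - by move=> u _; exact: mfunctional_ge0.
  rewrite -qE muleC -tE -integral_cst//; apply: ge0_le_integral => //.
  - by move=> u _ /=; exact: mfunctional_ge0.
  - apply: emeasurable_funD; last exact: measurable_funeM.
    by apply: measurable_funTS; exact: measurable_mfunctional_excl.
have J0 : 0 <= J setT (Z lam) T by apply: mfunctional_ge0; exact: mfunctional_J.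
rewrite qE tE; case: (J setT (Z lam) T) J0 int_le => [j| |//]; last first.
  have kapp : (0 < kap)%R.
    rewrite lt_neqAle kap0 andbT; apply/eqP => k0.
    by move: kapK; rewrite -k0 mul0r => /eqP; rewrite eq_sym oner_eq0.
  by move=> _ _; rewrite muleA -EFinM gt0_muley ?leey// lte_fin mulr_gt0.
rewrite -!EFinM -!EFinD !lee_fin => j0 H.
have := ler_wpM2l (mulr_ge0 kap0 lam0) H.
have -> : (lam * t * q = (kap * (1 - lam * K)) * (lam * t * q))%R by rewrite kapK mul1r.
lra.
Qed.

(** The trade-off between few and many centers in the ball. With [s = lam * mu T'], convexity gives
    [expR z >= (1 + z - s) * expR s], and [expR s] bounds the partition function of [T']. The
    remaining term, [s] times that partition function, is bounded by [local_mean]. The factor [1] is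
    the weight of an empty ball, kept visible for [expJ1]. *)
Lemma local_bound v T : measurable T -> T `<=` S ->
  (1 + z)%:E * Z lam (T `&` blocked v) <=
  (expR z)%:E * 1 + (kap * lam)%:E * J (blocked v) (fun U => Z lam (U `&` blocked v)) T.
Proof.
move=> mT TS; rewrite J_restr; set T' := T `&` blocked v.
have mT' : measurable T' by exact: measurableI.
have T'oo : mu T' < +oo.
  by apply: le_lt_trans Soo; apply: mu_sub => // x [/TS].
have := local_mean mT' (@subIsetr _ _ _) T'oo.
have [t tE] : exists t : R, mu T' = t%:E.
  by exists (fine (mu T')); rewrite fineK// ge0_fin_numE.
have Zle : Z lam T' <= (expR (lam * t))%:E by apply: Z_le_expR => //; rewrite tE.
have [q qE] : exists q : R, Z lam T' = q%:E.
  exists (fine (Z lam T')); rewrite fineK// ge0_fin_numE; last exact: mfunctional_ge0.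
  by rewrite (le_lt_trans Zle) ?ltry.
rewrite muleA -EFinM => H; apply: (@le_trans _ _ ((expR z)%:E * 1 + lam%:E * mu T' * Z lam T')).
  move: Zle; rewrite mule1 tE qE -!EFinM -EFinD !lee_fin => Zle.
  have q0 : (0 <= q)%R by rewrite -lee_fin -qE; exact: mfunctional_ge0.
  have := @expR_ge1Dx R (z - lam * t).
  move=> /(ler_wpM2r q0).
  have -> : expR z = (expR (z - lam * t) * expR (lam * t))%R by rewrite -expRD subrK.
  have := ler_wpM2l (expR_ge0 (z - lam * t)) Zle; lra.
by rewrite leeD2l.
Qed.

(** [local_bound] is averaged over the centers outside the blocked ball of [v] by applying [expJ].
    The first term becomes the weight of the event that [v] is uncovered. In the second, the
    insertion commutes with [expJ], and [Z_split] read backwards restores the full gas, which leaves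
    the mean number of centers in the ball. *)
Lemma bound_at v : (1 + z)%:E * Z lam S <=
  (expR z)%:E * Z lam (excl S v) + (kap * lam)%:E * J (blocked v) (Z lam) S.
Proof.
have mW : measurable (slice C v) by exact: measurable_slice.
pose Zv T := Z lam (T `&` blocked v).
have gZv : mfunctional Zv by exact: mfunctional_restr.
have gJ : mfunctional (J (blocked v) Zv) by exact: mfunctional_J.
have kl0 : (0 <= kap * lam)%R by rewrite mulr_ge0.
have z1 : (0 <= 1 + z)%R by rewrite addr_ge0.
have ez0 := expR_ge0 z.
have split T : measurable T -> Z lam T = expJ lam (slice C v) Zv T.
  by move=> mT; exact: Z_split.
rewrite split// -expJZ//.
apply: (@le_trans _ _ (expJ lam (slice C v) (fun T =>
   (expR z)%:E * 1 + (kap * lam)%:E * J (blocked v) Zv T) S)).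
  apply: expJ_le => //; first exact: mfunctional_scale.
    by apply: mfunctional_add; apply: mfunctional_scale.
  by move=> T mT TS; exact: local_bound.
rewrite expJD//; [|exact: mfunctional_scale..].
rewrite !expJZ// expJ1 expJ_J//; apply: leeD => //; apply: lee_wpmul2l => //.
rewrite le_eqVlt; apply/orP; left; apply/eqP; apply: eq_integral => u _.
by rewrite -split//; exact: measurable_excl.
Qed.

(** By Tonelli and the symmetry of [C], a center at [u] is counted only by those [v] in [S] that [u]
    blocks, a set of volume at most [M]. *)
Lemma int_J_blocked : measurable_fun S (fun v => J (blocked v) (Z lam) S) /\
  \int[mu]_(v in S) J (blocked v) (Z lam) S <= M%:E * J setT (Z lam) S.
Proof.
pose D : set (X * X) := (fst @^-1` S `&` snd @^-1` S) `&` ~` C.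
have mD : measurable D.
  apply: measurableI; last exact: measurableC.
  by apply: measurableI; rewrite -[X in measurable X]setTI;
    [exact: measurable_fst|exact: measurable_snd].
have mZu : measurable_fun setT (fun u => Z lam (excl S u)).
  exact: measurable_mfunctional_excl.
pose h := (fun q : X * X => Z lam (excl S q.2)) \_ D.
have h0 q : 0 <= h q by apply: erestrict_ge0 => x _; exact: mfunctional_ge0.
have mh : measurable_fun setT h.
  apply/(measurable_restrictT _ _).1 => //; apply: measurable_funTS.
  exact: (measurableT_comp mZu measurable_snd).
have hE v : S v -> \int[mu]_u h (v, u) = J (blocked v) (Z lam) S.
  move=> Sv; rewrite /insertion [RHS]integral_mkcond; apply: eq_integral => u _.
  rewrite /h !patchE.
  congr (if _ then _ else _); apply/idP/idP; rewrite !inE /D/=; last by case.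
  by case=> -[].
split.
  apply: (eq_measurable_fun (fun v => \int[mu]_u h (v, u))).
    by move=> v /set_mem Sv; exact: hE.
  apply: measurable_funTS.
  exact: (@measurable_fun_fubini_tonelli_F _ _ _ _ _ mu h mh h0).
rewrite integral_mkcond (eq_integral (fun v => \int[mu]_u h (v, u))); last first.
  move=> v _; rewrite patchE; case: ifPn => [|/negP]; rewrite inE => Sv.
    exact/esym/hE.
  rewrite integral0_eq// => u _; rewrite /h patchE ifF//.
  by apply/negbTE/negP; rewrite inE => -[[]].
rewrite (@fubini_tonelli _ _ _ _ _ mu mu _ mh h0).
rewrite /insertion setIT -ge0_integralZl_EFin//; last 2 first.
- by move=> u _; exact: mfunctional_ge0.
- exact: measurable_funTS.
rewrite [leRHS]integral_mkcond; apply: ge0_le_integral => //.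
- by move=> u _; exact: integral_ge0.
- exact: (@measurable_fun_fubini_tonelli_G _ _ _ _ _ mu h mh h0).
- apply/(measurable_restrictT _ _).1 => //; apply: measurable_funTS.
  exact: measurable_funeM.
move=> u _; rewrite patchE; case: ifPn => [|/negP]; rewrite inE => Su; last first.
  rewrite integral0_eq// => v _; rewrite /h patchE ifF//.
  by apply/negbTE/negP; rewrite inE => -[[]].
apply: (@le_trans _ _ (\int[mu]_(v in blocked u) Z lam (excl S u))).
  rewrite [leRHS]integral_mkcond; apply: ge0_le_integral => //.
  - exact: measurableT_comp.
  - by apply/(measurable_restrictT _ _).1 => //.
  move=> v _; rewrite /h !patchE; case: ifPn => [|_]; rewrite ?inE.
    by move=> [_ /= nC]; rewrite ifT// inE => Cuv; apply: nC; exact: symC.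
  by apply: erestrict_ge0 => x _; exact: mfunctional_ge0.
by rewrite integral_cst// muleC; apply: lee_wpmul2r; [exact: (mfunctional_ge0 _ gZ)|exact: SM].
Qed.

(** [bound_at] is integrated over [v] in [S]. The uncovered weight integrates to [J setT (Z lam) S]
    exactly, so both terms on the right are multiples of the mean number. Only [v] in [S] occur, so
    the shape of [S] does not matter. *)
Lemma mean_number_ge : ((1 + z) * lam)%:E * mu S * Z lam S <=
  (expR z + kap * lam * M)%:E * (lam%:E * J setT (Z lam) S).
Proof.
have z1 : (0 <= 1 + z)%R by rewrite addr_ge0.
have kl0 : (0 <= kap * lam)%R by rewrite mulr_ge0.
have ez0 := expR_ge0 z.
have J0 : 0 <= J setT (Z lam) S by apply: mfunctional_ge0; exact: mfunctional_J.
have mZu : measurable_fun setT (fun u => Z lam (excl S u)).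
  exact: measurable_mfunctional_excl.
have [mJ intJ] := int_J_blocked.
suff H : (1 + z)%:E * (mu S * Z lam S) <= (expR z + kap * lam * M)%:E * J setT (Z lam) S.
  rewrite mulrC EFinM -!muleA [leRHS]muleCA; apply: lee_wpmul2l => //.
apply: (@le_trans _ _ (\int[mu]_(v in S) ((expR z)%:E * Z lam (excl S v) +
   (kap * lam)%:E * J (blocked v) (Z lam) S))).
  rewrite (muleC (mu S)) muleA -integral_cst//; apply: ge0_le_integral => //.
  - by move=> u _ /=; rewrite mule_ge0//; exact: mfunctional_ge0.
  - apply: emeasurable_funD; apply: measurable_funeM => //.
    exact: measurable_funTS.
  - by move=> v _; exact: bound_at.
have J0' v : 0 <= J (blocked v) (Z lam) S by apply: mfunctional_ge0; exact: mfunctional_J.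
rewrite ge0_integralD//; first last.
- exact: measurable_funeM.
- by move=> v _; rewrite mule_ge0.
- by apply: measurable_funeM; exact: measurable_funTS.
- by move=> v _; rewrite mule_ge0//; exact: mfunctional_ge0.
rewrite !ge0_integralZl_EFin//; first last.
- exact: measurable_funTS.
- by move=> v _; exact: mfunctional_ge0.
rewrite EFinD ge0_muleDl ?lee_fin ?mulr_ge0//; apply: leeD.
  by rewrite /insertion setIT.
by rewrite [X in _ <= X * _]EFinM -muleA lee_wpmul2l//; exact: intJ.
Qed.

End mean_number.

End partition_function.

(** * Submultiplicativity of [Z], and multiplicativity for distant sets *)

Section multiplicativity.
Context (d : measure_display) (X : measurableType d) (R : realType).
Variable mu : {sigma_finite_measure set X -> \bar R}.
Variable C : set (X * X).
Hypothesis mC : measurable C.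
Hypothesis symC : forall x y, C (x, y) -> C (y, x).
Variable lam : R.
Hypothesis lam0 : (0 <= lam)%R.
Local Open Scope ereal_scope.
Local Notation Z := (Z mu C lam).
Local Notation G := (insertion_iter mu C).
Local Notation excl := (excl C).

Implicit Types (S W A B D : set X).

Lemma Z_fin S : measurable S -> mu S < +oo -> Z S \is a fin_num.
Proof.
move=> mS Soo; have Sfin : mu S \is a fin_num by rewrite ge0_fin_numE.
rewrite ge0_fin_numE; last exact: le_trans (Z_ge1 _ _ _ lam0).
by rewrite (le_lt_trans (Z_le_expR mC lam0 mS (_ : _ <= (fine (mu S))%:E))) ?ltry// fineK.
Qed.

Lemma Z_finite S (V : R) : measurable S -> mu S = V%:E ->
  exists2 q : R, (1 <= q)%R & Z S = q%:E.
Proof.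
move=> mS SV; have Zfin : Z S \is a fin_num by apply: Z_fin; rewrite ?SV ?ltry.
by exists (fine (Z S)); rewrite ?fineK// -lee_fin fineK// Z_ge1.
Qed.

Lemma Z_set0 : Z set0 = 1.
Proof.
apply/eqP; rewrite eq_le Z_ge1// andbT.
by rewrite (le_trans (Z_le_expR mC lam0 measurable0 (_ : _ <= 0%:E))) ?measure0// mulr0 expR0.
Qed.

(** In [Z_split] the inner gas lives on a subset of [S] outside [W], so by monotonicity its
    partition function is at most a constant, which leaves the exponential. *)
Lemma Z_submul S W : measurable S -> measurable W -> mu S < +oo ->
  Z S <= Z (S `&` W) * Z (S `&` ~` W).
Proof.
move=> mS mW Soo; have mW' := measurableC mW.
have mSW' : measurable (S `&` ~` W) by exact: measurableI.
have Wfin : Z (S `&` ~` W) \is a fin_num.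
  apply: Z_fin => //; apply: le_lt_trans Soo.
  by apply: le_measure; rewrite ?inE// ; exact: subIsetl.
have g1 : mfunctional (fun _ : set X => 1 : \bar R) by exact: (mfunctional_cst _ ler01).
have c0 : (0 <= fine (Z (S `&` ~` W)))%R.
  by rewrite fine_ge0// (le_trans _ (Z_ge1 _ _ _ lam0)).
have gZ : mfunctional Z by exact: mfunctional_Z.
rewrite (Z_split mu mC symC lam0 mW mS) muleC -(expJ1 mu C lam W S) -(fineK Wfin).
rewrite -(expJZ mu mC)//; apply: expJ_le => //.
- exact: mfunctional_restr.
- exact: mfunctional_scale.
- move=> T mT TS; rewrite mule1 fineK//; apply: (Z_sub mu mC) => //.
    exact: measurableI.
  exact: setSI.
Qed.

Lemma Z_union_le A B : measurable A -> measurable B -> mu A < +oo -> mu B < +oo ->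
  Z (A `|` B) <= Z A * Z B.
Proof.
move=> mA mB Aoo Boo; have mAB : measurable (A `|` B) by exact: measurableU.
have ABoo : mu (A `|` B) < +oo.
  by rewrite (le_lt_trans (measureU2 _ mA mB))// lte_add_pinfty.
apply: (le_trans (Z_submul mAB mA ABoo)).
rewrite setUK; apply: lee_wpmul2l; first exact: le_trans (Z_ge1 _ _ _ lam0).
apply: (Z_sub mu mC) => //; first by apply: measurableI => //; exact: measurableC.
by move=> x [[]].
Qed.

Lemma Z_bigcup_le (I : Type) (s : seq I) (A : I -> set X) :
  (forall i, measurable (A i)) -> (forall i, mu (A i) < +oo) ->
  Z (\big[setU/set0]_(i <- s) A i) <= \prod_(i <- s) Z (A i).
Proof.
move=> mA Aoo; pose U s := \big[setU/set0]_(i <- s) A i.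
have mU r : measurable (U r) by apply: bigsetU_measurable.
have Uoo r : mu (U r) < +oo.
  elim: r => [|i r IH]; first by rewrite /U big_nil measure0.
  rewrite /U big_cons; apply: (le_lt_trans (measureU2 _ (mA i) (mU r))).
  exact: lte_add_pinfty (Aoo i) IH.
elim: s => [|i s IH]; first by rewrite !big_nil Z_set0.
rewrite !big_cons; apply: (le_trans (Z_union_le (mA i) (mU s) (Aoo i) (Uoo s))).
apply: lee_wpmul2l => //; exact: le_trans (Z_ge1 _ _ _ lam0).
Qed.

(** Centers in [W] remove nothing from [D], the part of [S] outside [W]. The inner partition
    function of [Z_split] therefore stays equal to [Z D] through all insertions, and the bound of
    [Z_submul] becomes an equality. *)
Lemma Z_far S W : measurable S -> measurable W -> mu S < +oo ->
  (forall u x, S u -> W u -> S x -> ~ W x -> C (u, x)) ->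
  Z S = Z (S `&` ~` W) * Z (S `&` W).
Proof.
move=> mS mW Soo far; have mW' := measurableC mW; set D := S `&` ~` W.
have GE k T : measurable T -> T `<=` S -> T `&` ~` W = D ->
    G W k (fun U => Z (U `&` ~` W)) T = Z D * G W k (fun=> 1) T.
  elim: k T => [|k IH] T mT TS TD /=; first by rewrite TD mule1.
  rewrite muleCA; congr (_ * _).
  have g1 : mfunctional (fun _ : set X => 1 : \bar R) by exact: (mfunctional_cst _ ler01).
  rewrite /insertion -ge0_integralZl//; first last.
  - exact: le_trans (Z_ge1 _ _ _ lam0).
  - by move=> u _; apply: mfunctional_ge0; exact: mfunctional_G.
  - by apply: measurable_funTS; apply: measurable_mfunctional_excl => //; exact: mfunctional_G.
  - exact: measurableI.
  apply: eq_integral => u; rewrite inE => -[Tu Wu]; apply: IH.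
  - exact: measurable_excl.
  - by move=> x [/TS].
  - rewrite -exclI TD; apply/seteqP; split => [x []//|x Dx]; split => //.
    by case: Dx => Sx nWx; apply: far => //; exact: TS.
rewrite (Z_split mu mC symC lam0 mW mS) -(expJ1 mu C lam W S) /expJ.
have D0 : 0 <= Z D by exact: le_trans (Z_ge1 _ _ _ lam0).
have Dfin : Z D \is a fin_num.
  apply: Z_fin; first exact: measurableI.
  by apply: le_lt_trans Soo; apply: le_measure; rewrite ?inE//; [exact: measurableI|exact: subIsetl].
rewrite -[in RHS](fineK Dfin) -nneseriesZl; last first.
  move=> k _; rewrite mule_ge0 ?lee_fin ?exprn_ge0//; apply: mfunctional_ge0; apply: mfunctional_G => //.
apply: eq_eseriesr => k _; rewrite muleCA; congr (_ * _); rewrite fineK//; exact: GE.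
Qed.

End multiplicativity.

(** * Invariance under measure-preserving maps that respect [C] *)

Section invariance.
Context (d : measure_display) (X : measurableType d) (R : realType).
Variable mu : {sigma_finite_measure set X -> \bar R}.
Variable C : set (X * X).
Hypothesis mC : measurable C.
Variable tau : X -> X.
Hypothesis mtau : measurable_fun setT tau.
Hypothesis mu_tau : forall A, measurable A -> mu (tau @^-1` A) = mu A.
Hypothesis C_tau : forall x y, C (tau x, tau y) <-> C (x, y).
Local Open Scope ereal_scope.

Lemma conf_preimage k S : measurable S -> conf mu C k (tau @^-1` S) = conf mu C k S.
Proof.
elim: k S => [//|k IH] S mS; rewrite /conf/=; congr (_ * _).
have mS' : measurable (tau @^-1` S) by rewrite -[X in measurable X]setTI; exact: mtau.
rewrite /insertion !setIT.
transitivity (\int[mu]_(u in tau @^-1` S) conf mu C k (excl C S (tau u))).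
  apply: eq_integral => u _; rewrite -IH; last exact: measurable_excl.
  congr (insertion_iter _ _ _ _ _ _); apply/seteqP; split => x [Sx]; rewrite /slice/= => Cx;
    by split => //; exact/C_tau.
transitivity (\int[pushforward mu tau]_(u in S) conf mu C k (excl C S u)).
  rewrite ge0_integral_pushforward//.
    apply: measurable_funTS; apply: measurable_mfunctional_excl => //; exact: mfunctional_conf.
  by move=> u _; exact: conf_ge0.
by apply: eq_measure_integral => A mA _; exact: mu_tau.
Qed.

Lemma Z_preimage lam S : measurable S -> Z mu C lam (tau @^-1` S) = Z mu C lam S.
Proof. by move=> mS; apply: eq_eseriesr => k _; rewrite conf_preimage. Qed.

End invariance.

Section far_union.
Context (d : measure_display) (X : measurableType d) (R : realType).
Variable mu : {sigma_finite_measure set X -> \bar R}.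
Variable C : set (X * X).
Hypothesis mC : measurable C.
Hypothesis symC : forall x y, C (x, y) -> C (y, x).
Variable lam : R.
Hypothesis lam0 : (0 <= lam)%R.
Local Open Scope ereal_scope.

(** [Z_far] peels off one set at a time; the clause [~ A i x] makes the sets disjoint. *)
Lemma Z_bigcup_ge (I : choiceType) (s : seq I) (A : I -> set X) : uniq s ->
  (forall i, measurable (A i)) -> (forall i, mu (A i) < +oo) ->
  (forall i j u x, i != j -> A i u -> A j x -> C (u, x) /\ ~ A i x) ->
  \prod_(i <- s) Z mu C lam (A i) <= Z mu C lam (\big[setU/set0]_(i <- s) A i).
Proof.
move=> us mA Aoo far; pose U s := \big[setU/set0]_(i <- s) A i.
have mU r : measurable (U r) by apply: bigsetU_measurable.
have Uoo r : mu (U r) < +oo.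
  elim: r => [|i r IH]; first by rewrite /U big_nil measure0.
  rewrite /U big_cons; apply: (le_lt_trans (measureU2 _ (mA i) (mU r))).
  exact: lte_add_pinfty (Aoo i) IH.
elim: s us => [_|i s IH /= /andP[si us]]; first by rewrite !big_nil Z_ge1.
rewrite !big_cons -/(U s).
have UE x : U s x -> exists2 j, j \in s & A j x.
  by rewrite /U -bigcup_seq => -[j /= js Ajx]; exists j.
have farU u x : A i u -> U s x -> C (u, x) /\ ~ A i x.
  move=> Au /UE[j js Ajx]; apply: far Au Ajx.
  by apply: contraNneq si => ->.
have ZE := @Z_far _ _ _ mu C mC symC lam lam0 (A i `|` U s) (A i).
rewrite ZE//; first last.
- by move=> u x _ Au [//|Ux] _; have [] := farU _ _ Au Ux.
- exact: (le_lt_trans (measureU2 _ (mA i) (mU s)) (lte_add_pinfty (Aoo i) (Uoo s))).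
- exact: measurableU.
rewrite setUK muleC; apply: lee_pmul => //.
- by apply: prode_ge0 => j _; exact: le_trans (Z_ge1 _ _ _ lam0).
- exact: le_trans (Z_ge1 _ _ _ lam0).
apply: (le_trans (IH us)); rewrite -/(U s) le_eqVlt; apply/orP; left; apply/eqP.
congr Z; apply/seteqP; split => x; last by move=> [[]].
move=> Ux; split; first by right.
by move=> Ax; have [_] := farU _ _ Ax Ux.
Qed.

End far_union.

(** * Balls and cubes in Euclidean space *)

Section lebesgue_affine.
Context (R : realType).
Local Notation mu1 := (@lebesgue_measure R).
Local Notation Rd d := (d.-tuple (measurableTypeR R)).
Local Open Scope ereal_scope.

Definition aff1 (rho t : R) : measurableTypeR R -> measurableTypeR R := fun x => (rho * x + t)%R.

Lemma measurable_aff1 rho t : measurable_fun setT (aff1 rho t).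
Proof. by apply: measurable_funD => //; apply: measurable_funM. Qed.

(** [rho] times the pushforward agrees with [mu1] on half-open intervals, and these determine
    Lebesgue measure. *)
Lemma lebesgue_aff1 rho t A : (0 < rho)%R -> measurable A ->
  mu1 (aff1 rho t @^-1` A) = (rho^-1)%:E * mu1 A.
Proof.
move=> rho0 mA.
have ro0 : (0 <= rho)%R by exact: ltW.
have mf := measurable_aff1 rho t; set f := aff1 rho t in mf *.
have [m mE] : exists m : {measure set (measurableTypeR R) -> \bar R},
    forall B, m B = mu1 (f @^-1` B).
  by unshelve (exists (pushforward mu1 f)).
rewrite (@lebesgue_measure_unique _ (mscale (NngNum ro0) m) _ A mA); last first.
  move=> _ [[a b]] _ <- /=; rewrite /mscale/= mE.
  rewrite (_ : f @^-1` _ = `]((a - t) / rho)%R, ((b - t) / rho)%R]%classic); last first.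
    apply/seteqP; split => x; rewrite /= !in_itv/= /aff1 ltr_pdivrMr// ler_pdivlMr//
      ltrBlDr lerBrDr (mulrC x)//.
  rewrite !lebesgue_measure_itv/= !lte_fin.
  rewrite ltr_pM2r ?invr_gt0// ltrD2r; case: ifP => _; rewrite ?mule0//.
  rewrite -!EFinB -EFinM; congr EFin; field; exact: lt0r_neq0.
by rewrite /= /mscale mE muleA -EFinM mulVf ?lt0r_neq0// mul1e.
Qed.

Lemma integral_aff1 rho t (g : measurableTypeR R -> \bar R) : (0 < rho)%R ->
  measurable_fun setT g -> (forall x, 0 <= g x) ->
  \int[mu1]_x g (aff1 rho t x) = (rho^-1)%:E * \int[mu1]_x g x.
Proof.
move=> rho0 mg g0.
have ri0 : (0 <= rho^-1)%R by rewrite invr_ge0 ltW.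
transitivity (\int[pushforward mu1 (aff1 rho t)]_x g x).
  rewrite ge0_integral_pushforward//; exact: measurable_aff1.
rewrite (eq_measure_integral (mscale (NngNum ri0) mu1)).
- by rewrite ge0_integral_mscale.
- exact: measurable_aff1.
- by move=> mf A mA _; exact: (lebesgue_aff1 t rho0 mA).
Qed.

Definition aff d (rho : R) (t : Rd d) (x : Rd d) : Rd d :=
  [tuple (rho * tnth x i + tnth t i)%R | i < d].

Lemma measurable_aff d rho (t : Rd d) : measurable_fun setT (aff rho t).
Proof.
apply/measurable_fun_tnthP => i.
rewrite (_ : _ \o _ = aff1 rho (tnth t i) \o (fun x => tnth x i)); last first.
  by apply/funext => x /=; rewrite tnth_mktuple.
apply: measurableT_comp; [exact: measurable_aff1|exact: measurable_tnth].
Qed.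

Lemma aff_tcons d rho (t : Rd d.+1) x (y : Rd d) :
  aff rho t (tcons (x, y)) = tcons (aff1 rho (thead t) x, aff rho [tuple of behead t] y).
Proof.
apply: eq_from_tnth => i; rewrite tnth_mktuple; case: (unliftP ord0 i) => [j ->|->].
  by rewrite !tnthS tnth_mktuple tnth_behead; congr (_ + tnth t _)%R; apply: val_inj; rewrite /= inordK// ltnS.
by [].
Qed.

(** Induction on the dimension: slicing off the first coordinate leaves an affine map of the others,
    and each coordinate contributes one factor [rho^-1]. *)
Lemma lebesgue_aff d rho (t : Rd d) A : (0 < rho)%R -> measurable A ->
  lebesgue_Rd R d (aff rho t @^-1` A) = (rho ^- d)%:E * lebesgue_Rd R d A.
Proof.
move=> rho0; elim: d t A => [|d IH] t A mA.
  rewrite expr0 invr1 mul1e /lebesgue_Rd/=; congr (_ _).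
  by apply/seteqP; split => x; rewrite /= (tuple0 x) (tuple0 (aff _ _ _)).
have mA' : measurable (@tcons _ (measurableTypeR R) d @^-1` A).
  by rewrite -[X in measurable X]setTI; exact: measurable_tcons.
pose g x := lebesgue_Rd R d (xsection (@tcons _ (measurableTypeR R) d @^-1` A) x).
have mg : measurable_fun setT g by exact: measurable_fun_xsection.
have LE B : lebesgue_Rd R d.+1 B =
    \int[mu1]_x lebesgue_Rd R d (xsection (@tcons _ (measurableTypeR R) d @^-1` B) x).
  by [].
rewrite !LE -/(g _).
transitivity (\int[mu1]_x ((rho ^- d)%:E * g (aff1 rho (thead t) x))).
  apply: eq_integral => x _; rewrite /g -(IH [tuple of behead t]); last first.
    exact: measurable_xsection.
  congr (lebesgue_Rd _ _ _); apply/seteqP; split => y;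
    by rewrite /xsection/= !inE/= aff_tcons.
rewrite ge0_integralZl_EFin//; first last.
- by rewrite invr_ge0 exprn_ge0// ltW.
- exact: (measurableT_comp mg (measurable_aff1 _ _)).
rewrite integral_aff1// muleA -EFinM; congr (_%:E * _).
by rewrite exprSr invfM.
Qed.

Local Close Scope ereal_scope.

Implicit Types (r s l : R).
Local Notation edist := Defs.edist.

Definition cube d (a : Rd d) l : set (Rd d) :=
  [set x | forall i, tnth a i <= tnth x i < tnth a i + l].

Lemma cubeE d (a : Rd d) l :
  cube a l = [set x : Rd d | forall i : 'I_d, `[tnth a i, tnth a i + l[%classic (tnth x i)].
Proof. by apply/seteqP; split => x /= h i; move: (h i); rewrite in_itv. Qed.

Lemma measurable_cube d (a : Rd d) l : measurable (cube a l).
Proof.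
rewrite cubeE (_ : mkset _ = \bigcap_(i in [set: 'I_d])
    (fun x : Rd d => tnth x i) @^-1` `[tnth a i, tnth a i + l[%classic); last first.
  by apply/seteqP; split => x /= h i; [move=> _; exact: h|exact: (h i Logic.I)].
apply: fin_bigcap_measurable => // i _.
by rewrite -[X in measurable X]setTI; exact: measurable_tnth.
Qed.

Lemma lebesgue_cube d (a : Rd d) l : 0 <= l -> lebesgue_Rd R d (cube a l) = (l ^+ d)%:E.
Proof.
move=> l0; rewrite cubeE /lebesgue_Rd.
pose A (i : 'I_d) : set (measurableTypeR R) := `[tnth a i, tnth a i + l[%classic.
have mA i : measurable (A i) by exact: measurable_itv.
transitivity (\prod_(i < d) @lebesgue_measure R (A i))%E.
  exact: (tuple_measure_box (@lebesgue_measure R) mA).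
rewrite (eq_bigr (fun=> l%:E)); last first.
  move=> i _; rewrite lebesgue_measure_itv/= lte_fin ltrDl.
  case: ltP => [_|l0']; first by rewrite -EFinB addrAC subrr add0r.
  by congr EFin; apply/eqP; rewrite eq_le l0.
by rewrite prodEFin big_const_ord iter_mulr_1.
Qed.

Lemma edist_ge0 d (x y : Rd d) : 0 <= edist x y.
Proof. exact: sqrtr_ge0. Qed.

Lemma edistC d (x y : Rd d) : edist x y = edist y x.
Proof. by congr Num.sqrt; apply: eq_bigr => i _; rewrite -sqrrN opprB. Qed.

Lemma edist_le d (x y : Rd d) r : 0 <= r ->
  (edist x y <= r) = (\sum_(i < d) (tnth x i - tnth y i) ^+ 2 <= r ^+ 2).
Proof.
move=> r0; rewrite -[in LHS](ger0_norm r0) -sqrtr_sqr ler_psqrt// nnegrE ?sqr_ge0//.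
by apply: sumr_ge0 => i _; exact: sqr_ge0.
Qed.

Lemma edist_add_le d (x y z : Rd d) r s : 0 < r -> 0 < s ->
  edist x y <= r -> edist y z <= s -> edist x z <= r + s.
Proof.
move=> r0 s0; have [r0' s0'] := (ltW r0, ltW s0).
rewrite !edist_le ?addr_ge0// => xy yz.
set A := \sum_(i < d) (tnth x i - tnth y i) ^+ 2 in xy.
set B := \sum_(i < d) (tnth y i - tnth z i) ^+ 2 in yz.
(* Young's inequality, with weights for which equality holds when the two differences are in the
   ratio [r : s]; the bounds then add up to exactly [(r + s) ^+ 2]. *)
apply: (@le_trans _ _ ((1 + s / r) * A + (1 + r / s) * B)).
  rewrite !mulr_sumr -big_split; apply: ler_sum => i _ /=.
  set a := tnth x i - tnth y i; set b := tnth y i - tnth z i.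
  have -> : tnth x i - tnth z i = a + b by rewrite /a /b addrA subrK.
  rewrite -subr_ge0.
  have -> : (1 + s / r) * a ^+ 2 + (1 + r / s) * b ^+ 2 - (a + b) ^+ 2 =
    (s * a - r * b) ^+ 2 / (r * s) by field; rewrite !lt0r_neq0.
  by rewrite divr_ge0 ?sqr_ge0// ltW// mulr_gt0.
have -> : (r + s) ^+ 2 = (1 + s / r) * r ^+ 2 + (1 + r / s) * s ^+ 2.
  by field; rewrite !lt0r_neq0.
by apply: lerD; apply: ler_wpM2l => //; rewrite addr_ge0// divr_ge0.
Qed.

Lemma edist_aff d rho (t x y : Rd d) : 0 <= rho ->
  edist (aff rho t x) (aff rho t y) = rho * edist x y.
Proof.
move=> rho0; rewrite /edist -[rho in RHS](ger0_norm rho0) -sqrtr_sqr -sqrtrM ?sqr_ge0//.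
congr Num.sqrt; rewrite mulr_sumr; apply: eq_bigr => i _.
by rewrite !tnth_mktuple; ring.
Qed.

(** The crude diameter [d * l] is enough, because the cubes keep a fixed side while the balls
    grow. *)
Lemma edist_cube d (a x y : Rd d) l : 0 <= l -> cube a l x -> cube a l y ->
  edist x y <= d%:R * l.
Proof.
move=> l0 xa ya; rewrite edist_le ?mulr_ge0//.
apply: (@le_trans _ _ (\sum_(i < d) l ^+ 2)).
  apply: ler_sum => i _; have /andP[x1 x2] := xa i; have /andP[y1 y2] := ya i.
  by rewrite -subr_ge0 subr_sqr; apply: mulr_ge0; lra.
rewrite big_const_ord iter_addr_0 -[leLHS]mulr_natl exprMn.
apply: ler_wpM2r; first exact: sqr_ge0.
by rewrite -natrX ler_nat; case: (d) => // m; rewrite -mulnn leq_pmulr.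
Qed.

Lemma measurable_edist d : measurable_fun setT (fun p : Rd d * Rd d => edist p.1 p.2).
Proof.
have ms : measurable_fun [set: R] (@Num.sqrt R).
  by apply: continuous_measurable_fun; exact: sqrt_continuous.
apply: (measurableT_comp ms).
apply: measurable_sum => i; apply: measurable_funX; apply: measurable_funB.
  exact: (measurableT_comp (measurable_tnth _) measurable_fst).
exact: (measurableT_comp (measurable_tnth _) measurable_snd).
Qed.

Lemma measurable_eball d (x : Rd d) r : measurable (eball x r).
Proof.
have := measurable_slice (E := [set p : Rd d * Rd d | edist p.1 p.2 <= r]) x.
apply; rewrite -[X in measurable X]setTI.
have := @measurable_edist d measurableT `]-oo, r]%classic (measurable_itv _).
by congr measurable; apply/seteqP; split => p [_]; rewrite /= in_itv.
Qed.

Lemma lebesgue_eball d (x : Rd d) r : 0 < r ->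
  lebesgue_Rd R d (eball x r) = ((r ^+ d)%:E * lebesgue_Rd R d (eball (origin R d) 1))%E.
Proof.
move=> r0; have r0' := ltW r0; have rd0 : r ^+ d != 0 by rewrite expf_neq0// lt0r_neq0.
rewrite (_ : eball (origin R d) 1 = aff r x @^-1` eball x r).
  rewrite lebesgue_aff//; last exact: measurable_eball.
  by rewrite muleA -EFinM mulfV// mul1e.
have E y : edist x (aff r x y) = r * edist (origin R d) y.
  rewrite -(edist_aff x)//; congr edist.
  by apply: eq_from_tnth => i; rewrite !tnth_mktuple mulr0 add0r.
apply/seteqP; split => y; rewrite /eball/= E; first by move=> ?; exact: ler_piMr.
by rewrite ger_pMr.
Qed.

Lemma unit_ball_volume d : exists2 v : R, 0 < v &
  lebesgue_Rd R d (eball (origin R d) 1) = v%:E.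
Proof.
have mB := measurable_eball (origin R d) 1.
(* The half-open cube with corner -1 needs a side larger than 2 to contain the closed unit ball; 3
   will do. *)
have B_le : (lebesgue_Rd R d (eball (origin R d) 1) <= (3 ^+ d)%:E)%E.
  rewrite -(lebesgue_cube [tuple -1 | i < d])//; apply: le_measure; rewrite ?inE//.
    exact: measurable_cube.
  move=> y; rewrite /eball/= edist_le// expr1n => h i; rewrite tnth_mktuple.
  have : (tnth y i) ^+ 2 <= 1.
    apply: le_trans h; rewrite (bigD1 i)//= tnth_mktuple sub0r sqrrN lerDl.
    by apply: sumr_ge0 => j _; exact: sqr_ge0.
  by move=> h1; apply/andP; split; nra.
have B_gt : (0 < lebesgue_Rd R d (eball (origin R d) 1))%E.
  pose l := d.+1%:R^-1 : R.
  have l0 : 0 < l by rewrite invr_gt0.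
  apply: (@lt_le_trans _ _ (lebesgue_Rd R d (cube (origin R d) l))).
    by rewrite lebesgue_cube ?ltW// lte_fin exprn_gt0.
  apply: le_measure; rewrite ?inE//; first exact: measurable_cube.
  move=> y yl; rewrite /eball/=; have ol : cube (origin R d) l (origin R d).
    by move=> i; rewrite tnth_mktuple lexx add0r.
  apply: (le_trans (edist_cube (ltW l0) ol yl)).
  by rewrite ler_pdivrMr// mul1r ler_nat.
move: (lebesgue_Rd R d _) B_le B_gt => [v| |]//= _ v0.
by exists v.
Qed.

(** [r0] shows that the set given to [xget] is nonempty. Whatever element [xget] returns, scaling
    yields all volumes once the radius is known to be positive. *)
Lemma unit_volume_radiusP d : (0 < d)%N ->
  0 < unit_volume_radius R d /\
  forall (x : Rd d) r, 0 < r ->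
    lebesgue_Rd R d (eball x r) = ((r / unit_volume_radius R d) ^+ d)%:E.
Proof.
move=> d0; have [v v0 vE] := unit_ball_volume d.
have dr0 : d%:R != 0 :> R by rewrite pnatr_eq0 -lt0n.
pose r0 := (v `^ d%:R^-1)^-1.
have r00 : 0 < r0 by rewrite invr_gt0 powR_gt0.
have r0E : r0 ^+ d * v = 1.
  rewrite exprVn -powR_mulrn ?powR_ge0// -powRrM mulVf// powRr1 ?ltW//.
  by rewrite mulVf// lt0r_neq0.
have : [set r | 0 <= r /\ lebesgue_Rd R d (eball (origin R d) r) = 1%E] !=set0.
  exists r0; split; first exact: ltW.
  by rewrite lebesgue_eball// vE -EFinM r0E.
move=> /(xgetPex 0); rewrite -/(unit_volume_radius R d).
set u := unit_volume_radius R d => -[u0 uE].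
have u1 : 0 < u.
  (* A radius 0 would give the ball of radius [r0 / 2] volume at least 1, whereas by scaling it has
     volume [2 ^- d]. *)
  rewrite lt_neqAle u0 andbT; apply/eqP => u00.
  have : (lebesgue_Rd R d (eball (origin R d) (r0 / 2)) >= 1)%E.
    rewrite -uE; apply: le_measure; rewrite ?inE; try exact: measurable_eball.
    by move=> y; rewrite /eball/= -u00 => /le_trans; apply; rewrite divr_ge0// ltW.
  rewrite lebesgue_eball ?divr_gt0// vE -EFinM lee_fin expr_div_n mulrAC r0E.
  rewrite leNgt => /negP; apply; rewrite mul1r invf_lt1 ?exprn_gt0//.
  by rewrite exprn_egt1 ?ltr1n// -lt0n.
split=> // x r r1; rewrite lebesgue_eball// vE -EFinM; congr EFin.
move: uE; rewrite lebesgue_eball// vE -EFinM => -[uE].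
have ud0 : u ^+ d != 0 by rewrite expf_neq0// lt0r_neq0.
by rewrite expr_div_n; congr (_ * _); apply: (mulfI ud0); rewrite uE mulfV.
Qed.

End lebesgue_affine.

(** * From set functionals back to integrals over tuples *)

Section tuple_configurations.
Context (d : measure_display) (X : measurableType d) (R : realType).
Variable mu : {sigma_finite_measure set X -> \bar R}.
Variable C : set (X * X).
Hypothesis mC : measurable C.
Hypothesis symC : forall x y, C (x, y) -> C (y, x).
Local Open Scope ereal_scope.

Definition compatible k : set (k.-tuple X) :=
  [set x | forall i j : 'I_k, i != j -> C (tnth x i, tnth x j)].

Lemma measurable_compatible k : measurable (@compatible k).
Proof.
rewrite (_ : @compatible k = \bigcap_(i in [set: 'I_k]) \bigcap_(j in [set j : 'I_k | i != j])
    (fun x : k.-tuple X => (tnth x i, tnth x j)) @^-1` C); last first.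
  apply/seteqP; split => x /= h i; first by move=> _ j /= ij; exact: h.
  by move=> j ij; exact: h ij.
apply: fin_bigcap_measurable => // i _; apply: fin_bigcap_measurable => // j _.
rewrite -[X in measurable X]setTI.
have mf : measurable_fun setT (fun x : k.-tuple X => (tnth x i, tnth x j)).
  by apply: measurable_fun_pair; exact: measurable_tnth.
exact: mf.
Qed.

Lemma measurable_power k (S : set X) : measurable S ->
  measurable [set x : k.-tuple X | forall i, S (tnth x i)].
Proof.
move=> mS; rewrite (_ : mkset _ = \bigcap_(i in [set: 'I_k])
    (fun x : k.-tuple X => tnth x i) @^-1` S); last first.
  by apply/seteqP; split => x /= h i; [move=> _; exact: h|exact: (h i Logic.I)].
apply: fin_bigcap_measurable => // i _.
by rewrite -[X in measurable X]setTI; exact: measurable_tnth.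
Qed.

(** Fixing the first center [u] leaves compatible tuples in [excl S u], which is the recursion of
    [conf]; the factorial counts the labelings of the centers. *)
Lemma tuple_measure_compatible k S : measurable S ->
  tuple_measure mu k (@compatible k `&` [set x | forall i, S (tnth x i)]) =
  (k`!%:R)%:E * conf mu C k S.
Proof.
elim: k S => [|k IH] S mS.
  rewrite mul1e /= diracE mem_set//; split => [[]//|[]//].
set A := _ `&` _.
have -> : tuple_measure mu k.+1 A =
  \int[mu]_u tuple_measure mu k (xsection (@tcons _ X k @^-1` A) u) by [].
have AE u : S u -> xsection (@tcons _ X k @^-1` A) u =
    @compatible k `&` [set x | forall i, excl C S u (tnth x i)].
  move=> Su; apply/seteqP; split => x; rewrite /xsection/= inE /A/=.
    move=> [cx Sx]; split.
      move=> i j ij; have := cx (lift ord0 i) (lift ord0 j).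
      by rewrite !tnthS; apply; rewrite (inj_eq lift_inj).
    move=> i; split; first by have := Sx (lift ord0 i); rewrite tnthS.
    by have := cx ord0 (lift ord0 i); rewrite tnthS; apply; exact: neq_lift.
  move=> [cx Sx]; split.
    move=> i j; case: (unliftP ord0 i) => [i' ->|->];
      case: (unliftP ord0 j) => [j' ->|->]; rewrite ?tnthS ?eqxx//.
    - by rewrite (inj_eq lift_inj); exact: cx.
    - by move=> _; apply: symC; have [] := Sx i'.
    - by move=> _; have [] := Sx j'.
  move=> i; case: (unliftP ord0 i) => [i' ->|->//]; rewrite tnthS.
  by have [] := Sx i'.
transitivity (\int[mu]_(u in S) ((k`!%:R)%:E * conf mu C k (excl C S u))).
  rewrite [RHS]integral_mkcond; apply: eq_integral => u _; rewrite patchE.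
  case: ifPn => [/set_mem Su|/negP].
    by rewrite (AE u Su); apply: IH; exact: measurable_excl.
  rewrite inE => Su; rewrite (_ : xsection _ _ = set0) ?measure0//.
  apply/seteqP; split => x //; rewrite /xsection/= inE => -[_] /(_ ord0).
  by move=> /Su.
rewrite ge0_integralZl_EFin//; first last.
- by apply: measurable_funTS; apply: measurable_mfunctional_excl => //; exact: mfunctional_conf.
- by move=> u _; exact: conf_ge0.
rewrite factS natrM mulrC EFinM -muleA; congr (_ * _).
by rewrite (confS mu C) /insertion setIT.
Qed.

End tuple_configurations.

Section hard_sphere_link.
Context (R : realType) (d : nat).
Local Notation Rd d := (d.-tuple (measurableTypeR R)).
Local Notation edist := Defs.edist.

Definition apart : set (Rd d * Rd d) :=
  [set p | 2 * unit_volume_radius R d < edist p.1 p.2].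

Lemma measurable_apart : measurable apart.
Proof.
rewrite -[X in measurable X]setTI.
have := @measurable_edist R d measurableT `]2 * unit_volume_radius R d, +oo[%classic
  (measurable_itv _).
by congr measurable; apply/seteqP; split => p [_]; rewrite /= in_itv/= andbT.
Qed.

Lemma apart_sym (x y : Rd d) : apart (x, y) -> apart (y, x).
Proof. by rewrite /apart/= edistC. Qed.

Lemma Zpart_Z (S : set (Rd d)) lam : measurable S ->
  Zpart S lam = Z (lebesgue_Rd R d) apart lam S.
Proof.
move=> mS; apply: eq_eseriesr => -[|k] _; first by [].
congr (_ * _)%E; rewrite /Zhat integral_indic//; last 2 first.
- exact: measurable_power.
- exact: (measurable_compatible measurable_apart).
have := tuple_measure_compatible (lebesgue_Rd R d) measurable_apart apart_sym k.+1 mS.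
move=> /(congr1 (fun x => ((k.+1)`!%:R^-1)%:E * x)%E) /= ->.
by rewrite muleA -EFinM mulVf ?mul1e// pnatr_eq0 -lt0n fact_gt0.
Qed.

End hard_sphere_link.

(** * The lower bound in a finite volume *)

Section symmetric_pairs.
Context (d : measure_display) (X : measurableType d) (R : realType).
Variable mu : {sigma_finite_measure set X -> \bar R}.
Variables (D : set (X * X)) (rho : X -> R) (T : set X) (K : R).
Hypotheses (mD : measurable D) (symD : forall x y, D (x, y) -> D (y, x)).
Hypotheses (mrho : measurable_fun setT rho) (mT : measurable T).
Local Open Scope ereal_scope.

(* Every pair is counted once from its endpoint of larger [rho]. *)
Lemma symmetric_pairs_le : (0 <= K)%R ->
  (forall u, T u -> mu (T `&` slice D u `&` [set x | rho x <= rho u]%R) <= K%:E) ->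
  \int[mu]_(u in T) mu (T `&` slice D u) <= (2 * K)%:E * mu T.
Proof.
move=> K0 HK.
pose A : set (X * X) := (fst @^-1` T `&` snd @^-1` T `&` D) `&` [set p | rho p.2 <= rho p.1]%R.
have mA : measurable A.
  apply: measurableI.
    apply: measurableI => //; apply: measurableI; rewrite -[X in measurable X]setTI;
      [exact: measurable_fst|exact: measurable_snd].
  rewrite -[X in measurable X]setTI.
  have m1 : measurable_fun setT (fun p : X * X => rho p.2).
    exact: (measurableT_comp mrho measurable_snd).
  have m2 : measurable_fun setT (fun p : X * X => rho p.1).
    exact: (measurableT_comp mrho measurable_fst).
  rewrite (_ : mkset _ = (fun p : X * X => (rho p.2 <= rho p.1)%R) @^-1` [set true]); last first.
    by apply/seteqP; split => p.
  exact: (measurable_fun_ler m1 m2).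
pose B : set (X * X) := (fun p => (p.2, p.1)) @^-1` A.
have msw : measurable_fun setT (fun p : X * X => (p.2, p.1)).
  exact: measurable_swap.
have mB : measurable B by rewrite -[X in measurable X]setTI; exact: msw.
have sA u : u \in T -> slice A u = T `&` slice D u `&` [set x | rho x <= rho u]%R.
  move=> /set_mem Tu; apply/seteqP; split => x; first by move=> [[[]]].
  by move=> [[]].
have sA0 u : ~ T u -> slice A u = set0.
  by move=> nT; apply/seteqP; split => x // -[[[]]].
have gm := mfunctional_measure mu.
have mA' : measurable_fun setT (fun u => mu (slice A u)) by exact: gm.2.
have mB' : measurable_fun setT (fun u => mu (slice B u)) by exact: gm.2.
have intA : \int[mu]_u mu (slice A u) <= K%:E * mu T.
  rewrite -integral_cst// [leRHS]integral_mkcond.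
  apply: ge0_le_integral => //.
    by apply/(measurable_restrictT _ _).1.
  move=> u _; rewrite patchE; case: ifPn => [uT|/negP].
    by rewrite sA//; apply: HK; exact: set_mem.
  by rewrite inE => nT; rewrite sA0// measure0.
have intB : \int[mu]_u mu (slice B u) = \int[mu]_u mu (slice A u).
  have h0 (E : set (X * X)) q : 0 <= (\1_E q)%:E :> \bar R by rewrite lee_fin.
  have mh (E : set (X * X)) : measurable E ->
      measurable_fun setT (fun q => (\1_E q)%:E : \bar R).
    by move=> mE; apply/measurable_EFinP; exact: measurable_indic.
  have E1 (E : set (X * X)) u : measurable E ->
      mu (slice E u) = \int[mu]_x (\1_E (u, x))%:E.
    move=> mE; rewrite -[X in mu X]setIT.
    by rewrite -integral_indic//; exact: measurable_slice.
  under eq_integral do rewrite E1//.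
  rewrite (@fubini_tonelli _ _ _ _ _ mu mu _ (mh _ mB) (h0 B)).
  by apply: eq_integral => u _; rewrite E1.
have TD u : measurable (T `&` slice D u) by apply: measurableI => //; exact: measurable_slice.
apply: (@le_trans _ _ (\int[mu]_u (mu (slice A u) + mu (slice B u)))); last first.
  rewrite ge0_integralD// intB mulr2n mulrDl mul1r EFinD ge0_muleDl ?lee_fin//.
  by rewrite leeD.
rewrite integral_mkcond; apply: ge0_le_integral => //.
- by move=> u _; apply: erestrict_ge0.
- apply/(measurable_restrictT _ _).1 => //; apply: measurable_funTS.
  apply: (gm.2 _ _ [set p | T p.2 /\ D p]); apply: measurableI => //.
  by rewrite -[X in measurable X]setTI; exact: measurable_snd.
- exact: emeasurable_funD.
move=> u _; rewrite patchE; case: ifPn => [/set_mem Tu|_]; last by rewrite adde_ge0.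
apply: (@le_trans _ _ (mu (slice A u `|` slice B u))); last first.
  by apply: measureU2; exact: measurable_slice.
apply: le_measure; rewrite ?inE//; first by apply: measurableU; exact: measurable_slice.
move=> x [Tx Dux]; case: (leP (rho x) (rho u)) => [le|/ltW le]; [left|right].
  by [].
by split => //; split => //; exact: symD.
Qed.

End symmetric_pairs.

Section finite_volume.
Context (R : realType) (d : nat).
Hypothesis d0 : (0 < d)%N.
Local Notation Rd := (d.-tuple (measurableTypeR R)).
Local Notation edist := Defs.edist.
Local Notation mu := (lebesgue_Rd R d).
Local Notation r := (unit_volume_radius R d).
Local Notation C := (@apart R d).
Local Notation Zd := (Z mu C).

Let r_gt0 : 0 < r. Proof. by have [] := @unit_volume_radiusP R d d0. Qed.

Let volE (x : Rd) s : 0 < s -> mu (eball x s) = ((s / r) ^+ d)%:E.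
Proof. by have [_] := @unit_volume_radiusP R d d0; apply. Qed.

Lemma blockedE (u : Rd) : ~` slice C u = eball u (2 * r).
Proof. by apply/seteqP; split => x; rewrite /slice/apart/eball/= leNgt => /negP. Qed.

Lemma lebesgue_blocked (u : Rd) : mu (~` slice C u) = (2 ^+ d)%:E.
Proof.
rewrite blockedE volE ?mulr_gt0//; congr (_ ^+ _)%:E.
by rewrite mulfK// lt0r_neq0.
Qed.

Definition midpoint (u v : Rd) : Rd := [tuple (tnth u i + tnth v i) / 2 | i < d].

(** By the parallelogram law, the squared distance from the midpoint to [x] is the mean of the
    squared distances from [u] and [v] to [x], minus a quarter of the squared distance of [u] and
    [v]. The hypotheses bound this by [s^2 / 2 + s^2 / 4]. *)
Lemma edist_midpoint (u v x : Rd) s : 0 <= s ->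
  edist u v <= s -> edist u x <= s -> edist v x <= edist v u ->
  edist (midpoint u v) x <= Num.sqrt 3 / 2 * s.
Proof.
move=> s0; have sq2 (y z : Rd) : edist y z ^+ 2 = \sum_(i < d) (tnth y i - tnth z i) ^+ 2.
  by rewrite sqr_sqrtr//; apply: sumr_ge0 => i _; exact: sqr_ge0.
move=> uv ux vx; have s3 : 0 <= Num.sqrt 3 / 2 * s :> R by rewrite !mulr_ge0 ?sqrtr_ge0.
rewrite edist_le//.
have -> : \sum_(i < d) (tnth (midpoint u v) i - tnth x i) ^+ 2 =
    (edist v x ^+ 2 + edist u x ^+ 2) / 2 - edist u v ^+ 2 / 4.
  rewrite !sq2 -big_split/= !mulr_suml -sumrB; apply: eq_bigr => i _.
  by rewrite tnth_mktuple; field.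
have e1 := edist_ge0 v x; have e2 := edist_ge0 u x; have e3 := edist_ge0 u v.
rewrite (edistC v u) in vx.
have -> : (Num.sqrt 3 / 2 * s) ^+ 2 = 3 / 4 * s ^+ 2 by rewrite !exprMn sqr_sqrtr//; field.
have h1 : edist v x ^+ 2 <= edist u v ^+ 2 by rewrite ler_pXn2r// nnegrE.
have h2 : edist u x ^+ 2 <= s ^+ 2 by rewrite ler_pXn2r// nnegrE.
have h3 : edist u v ^+ 2 <= s ^+ 2 by rewrite ler_pXn2r// nnegrE.
lra.
Qed.

(** Points blocked by [u] and no farther from [v] than [u] lie in a ball of radius [Num.sqrt 3 * r]
    around the midpoint, of volume [Num.sqrt 3 ^+ d]. Counting each pair from its endpoint farther
    from [v] costs the factor 2. *)
Lemma local_overlap (v : Rd) T : measurable T -> T `<=` ~` slice C v ->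
  (\int[mu]_(u in T) mu (T `&` ~` slice C u) <= (2 * Num.sqrt 3 ^+ d)%:E * mu T)%E.
Proof.
move=> mT Tv; have K0 : 0 <= Num.sqrt 3 ^+ d :> R by rewrite exprn_ge0// sqrtr_ge0.
have := @symmetric_pairs_le _ Rd R mu (~` C) (edist v) T (Num.sqrt 3 ^+ d).
apply => //.
- by apply: measurableC; exact: measurable_apart.
- by move=> x y nC /apart_sym.
- exact: (measurable_fun_pair2 v (@measurable_edist R d)).
move=> u Tu.
have s3 : 0 < Num.sqrt 3 :> R by rewrite sqrtr_gt0.
rewrite (_ : Num.sqrt 3 = Num.sqrt 3 * r / r); last by rewrite mulfK// lt0r_neq0.
rewrite -(volE (midpoint u v)) ?mulr_gt0//; apply: le_measure; rewrite ?inE.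
- apply: measurableI; last first.
    have := @measurable_eball R d v (edist v u).
    by congr measurable; apply/seteqP; split.
  by apply: measurableI => //; exact: (@measurable_slice _ Rd _ Rd (~` C) u (measurableC (@measurable_apart R d))).
- exact: measurable_eball.
move=> x [[Tx ux] vx]; have vu : ~ C (v, u) := Tv _ Tu.
have le2 (y z : Rd) : ~ C (y, z) -> edist y z <= 2 * r.
  by rewrite /apart/= => /negP; rewrite -leNgt.
rewrite /eball/=; have -> : Num.sqrt 3 * r = Num.sqrt 3 / 2 * (2 * r) :> R.
  by rewrite mulrA divfK// pnatr_eq0.
apply: edist_midpoint => //; [by rewrite mulr_ge0// ltW|rewrite edistC; exact: le2|exact: le2].
Qed.

Section volume.
Variables (S : set Rd) (V : R).
Hypotheses (mS : measurable S) (SV : mu S = V%:E).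

Definition lnZ lam := ln (fine (Zd lam S)).

Let mC := @measurable_apart R d.
Let symC := @apart_sym R d.

Let V0 : 0 <= V. Proof. by rewrite -lee_fin -SV. Qed.

Let ZE lam : 0 <= lam -> exists2 q : R, 1 <= q & Zd lam S = q%:E.
Proof. by move=> l0; exact: Z_finite mS SV. Qed.

Lemma lnZ_ge0 lam : 0 <= lam -> 0 <= lnZ lam.
Proof. by move=> l0; rewrite /lnZ; have [q q1 ->] := ZE l0; exact: ln_ge0. Qed.

(** [mean_number_ge] feeds [Z_jensen]. It is used with [K = q / lam], so that [lam * K] is exactly
    [q], with [M = 2 ^+ d] by [lebesgue_blocked], and with [kap = (1 - q)^-1]. *)
Lemma lnZ_step lam q h z : 0 < lam -> 0 <= h -> 0 <= z ->
  lam * (2 * Num.sqrt 3 ^+ d) <= q -> q < 1 ->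
  lnZ lam + h * (V * ((1 + z) * lam / (expR z + (1 - q)^-1 * lam * 2 ^+ d)))
    <= lnZ (expR h * lam).
Proof.
move=> l0 h0 z0 lq q1; have l0' := ltW l0.
have el0 : 0 <= expR h * lam by rewrite mulr_ge0 ?expR_ge0.
have q1' : 0 < 1 - q by rewrite subr_gt0.
have den0 : 0 < expR z + (1 - q)^-1 * lam * 2 ^+ d.
  by rewrite addr_gt0 ?expR_gt0// !mulr_gt0 ?invr_gt0 ?exprn_gt0.
set m := V * _.
have m0 : 0 <= m.
  by rewrite mulr_ge0// divr_ge0 ?(ltW den0)// mulr_ge0// addr_ge0.
have K0 : 0 <= q / lam.
  apply: divr_ge0 => //; apply: le_trans lq.
  by rewrite !mulr_ge0// exprn_ge0// sqrtr_ge0.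
have mean := @mean_number_ge _ Rd R mu C mC symC lam (q / lam) (2 ^+ d) (1 - q)^-1 z S l0.
have {}mean : ((m)%:E * Zd lam S <= lam%:E * insertion mu C setT (Zd lam) S)%E.
  have := mean _ _ _ z0 mS.
  have -> : (1 - q)^-1 * (1 - lam * (q / lam)) = 1.
    by rewrite mulrCA mulfV ?lt0r_neq0// mulr1 mulVf ?lt0r_neq0.
  rewrite SV ltry => /(_ (exprn_ge0 _ (ler0n _ _))).
  rewrite invr_ge0 (ltW q1') => /(_ isT erefl isT).
  have H1 u : (mu (~` slice C u) <= (2 ^+ d)%:E)%E by rewrite lebesgue_blocked.
  move=> /(_ H1).
  have H2 v T : measurable T -> T `<=` ~` slice C v -> (mu T < +oo)%E ->
     (\int[mu]_(u in T) mu (T `&` ~` slice C u) <= (q / lam)%:E * mu T)%E.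
    move=> mT Tv Too; apply: (le_trans (local_overlap mT Tv)).
    by apply: lee_wpmul2r => //; rewrite lee_fin ler_pdivlMr// mulrC.
  move=> /(_ H2).
  have J0 : (0 <= insertion mu C setT (Zd lam) S)%E.
    by apply: mfunctional_ge0; apply: mfunctional_J => //; exact: mfunctional_Z.
  have [z' _ ->] := ZE l0'; move: (insertion mu C setT (Zd lam) S) J0 => [j| |//] j0; last first.
    by move=> _; rewrite gt0_muley ?lte_fin ?leey.
  rewrite -!EFinM !lee_fin => H; rewrite /m.
  rewrite -(ler_pM2l den0); apply: le_trans H.
  rewrite le_eqVlt; apply/orP; left; apply/eqP.
  move: (expR z + _) den0 => den den0.
  by field; exact: lt0r_neq0.
have Zoo : (Zd lam S < +oo)%E by have [z' _ ->] := ZE l0'; rewrite ltry.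
have := Z_jensen mC l0' h0 m0 mS Zoo mean.
rewrite /lnZ; have [a a1 ->] := ZE l0'; have [b b1 ->] := ZE el0.
rewrite -EFinM lee_fin => H.
have a0 := lt_le_trans ltr01 a1; have b0 := lt_le_trans ltr01 b1.
rewrite -[X in _ + X]expRK -lnM ?posrE ?expR_gt0//.
by rewrite ler_ln ?posrE ?mulr_gt0 ?expR_gt0// mulrC.
Qed.

(** The fugacities [lam j] decrease geometrically from the target at [j = 0], and [lam n.+2] would
    be [2 ^- d]. Going from [lam j] to [lam j.-1] gains an amount proportional to [n + 1 - j], and
    the gains for [1 <= j <= n] add up to [n * (n + 1) / 2]. *)
Lemma lnZ_ge c h n : ln 3 / 2 <= c -> 0 < h -> n.+2%:R * h = (ln 2 - c) * d%:R ->
  2 * expR (- h) < 1 ->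
  V * (h ^+ 2 * (n%:R * n.+1%:R / 2) /
    ((expR (- h) + (1 - 2 * expR (- h))^-1) * 2 ^+ d))
    <= lnZ (expR (- (c * d%:R))).
Proof.
move=> c3 h0 hn q1; set q := 2 * expR (- h) in q1 *.
have h0' := ltW h0.
set D := expR (- h) + (1 - q)^-1.
have kap0 : 0 < (1 - q)^-1 by rewrite invr_gt0 subr_gt0.
have D0 : 0 < D by rewrite addr_gt0 ?expR_gt0.
have p2 : 0 < 2 ^+ d :> R by rewrite exprn_gt0.
have sqrt3 : Num.sqrt 3 ^+ d = expR (ln 3 / 2 * d%:R) :> R.
  rewrite -powR12_sqrt// -powR_mulrn ?powR_ge0// -powRrM /powR ifF.
    by congr expR; ring.
  by apply/negbTE; rewrite pnatr_eq0.
have pow2 : 2 ^+ d = expR (ln 2 * d%:R) :> R.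
  by rewrite mulrC expRM_natl lnK// posrE.
pose lam j := expR (- (c * d%:R + j%:R * h)).
have step j : (j <= n)%N -> (0 < j)%N ->
    lnZ (lam j) + V * (h ^+ 2 * (n.+1%:R - j%:R) / (D * 2 ^+ d)) <= lnZ (lam j.-1).
  (* With this [z], [expR z] equals [lam j * 2 ^+ d * expR (- h)], so both terms of the denominator
     are multiples of [lam j * 2 ^+ d] and the fugacity cancels. *)
  move=> jn j0; pose z := (n.+1%:R - j%:R) * h.
  have z0 : 0 <= z by rewrite mulr_ge0// subr_ge0 ler_nat (leq_trans jn).
  have lamj0 : 0 < lam j by exact: expR_gt0.
  (* Here [ln 3 / 2 <= c] enters, and [0 < j] supplies the factor [expR (- h)] of [q]. *)
  have lamq : lam j * (2 * Num.sqrt 3 ^+ d) <= q.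
    rewrite mulrCA sqrt3 -expRD; apply: ler_wpM2l => //; rewrite ler_expR.
    have : ln 3 / 2 * d%:R <= c * d%:R by rewrite ler_wpM2r.
    have : h <= j%:R * h by rewrite ler_peMl// ler1n.
    lra.
  have := lnZ_step lamj0 h0' z0 lamq q1.
  have -> : expR h * lam j = lam j.-1.
    rewrite /lam -expRD; congr expR; rewrite -[in LHS](prednK j0) -natr1; ring.
  apply: le_trans; rewrite lerD2l [leRHS]mulrCA; apply: ler_wpM2l => //.
  have -> : expR z + (1 - q)^-1 * lam j * 2 ^+ d = lam j * 2 ^+ d * D.
    have -> : expR z = lam j * 2 ^+ d * expR (- h).
      rewrite pow2 /lam -!expRD; congr expR.
      have := hn; rewrite /z -!natr1; lra.
    by rewrite /D; ring.
  have -> : h * ((1 + z) * lam j / (lam j * 2 ^+ d * D)) = h * (1 + z) / (D * 2 ^+ d).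
    by field; rewrite !lt0r_neq0.
  rewrite ler_pM2r ?invr_gt0 ?mulr_gt0// /z.
  have := h0'; set y := n.+1%:R - j%:R => ?; have := mulr_ge0 h0' h0'; nra.
(* The subtracted form is the sum of [n + 1 - i] over [1 <= i <= j]. At [j = n] the remaining
   [lnZ (lam n)] is nonnegative and is dropped. *)
suff H j : (j <= n)%N -> lnZ (lam j) +
    V * (h ^+ 2 * (j%:R * n%:R - j%:R * (j%:R - 1) / 2) / (D * 2 ^+ d)) <= lnZ (lam 0%N).
  have := H n (leqnn n); rewrite {2}/lam mul0r addr0; apply: le_trans.
  have -> : n%:R * n%:R - n%:R * (n%:R - 1) / 2 = n%:R * n.+1%:R / 2 :> R.
    by rewrite -natr1; field.
  by rewrite lerDr lnZ_ge0// expR_ge0.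
elim: j => [_|j IH jn]; first by rewrite !mul0r subr0 mulr0 mul0r mulr0 addr0.
apply: le_trans (IH (ltnW jn)); have := step _ jn isT; rewrite /=.
set P := (D * _)^-1 => stepj.
rewrite (_ : V * (h ^+ 2 * (j.+1%:R * n%:R - j.+1%:R * (j.+1%:R - 1) / 2) * P) =
    V * (h ^+ 2 * (n.+1%:R - j.+1%:R) * P) +
    V * (h ^+ 2 * (j%:R * n%:R - j%:R * (j%:R - 1) / 2) * P)).
  have addl (x y z w : R) : x + y <= z -> x + (y + w) <= z + w.
    by move=> xyz; rewrite addrA lerD2r.
  exact: addl stepj.
by rewrite -!natr1; field.
Qed.

End volume.
End finite_volume.

(** * Existence of the pressure *)

Section disjoint_copies.
Context (d : measure_display) (X : measurableType d) (R : realType).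
Variable mu : {measure set X -> \bar R}.

Lemma measure_disjoint_copies (I : choiceType) (s : seq I) (A : I -> set X) (v : R) :
  uniq s -> (forall i, measurable (A i)) -> (forall i, mu (A i) = v%:E) ->
  (forall i j x, i \in s -> j \in s -> i != j -> A i x -> ~ A j x) ->
  mu (\big[setU/set0]_(i <- s) A i) = ((size s)%:R * v)%:E.
Proof.
move=> us mA Av; elim: s us => [_ _|i s IH /= /andP[si us] tA].
  by rewrite big_nil measure0 mul0r.
have {}IH : mu (\big[setU/set0]_(i <- s) A i) = ((size s)%:R * v)%:E.
  by apply: IH => // j k x js ks; apply: tA; rewrite inE ?js ?ks orbT.
set U := \big[setU/set0]_(i <- s) A i in IH *.
have iU : A i `&` U = set0.
  apply/seteqP; split => x // -[Aix]; rewrite /U -bigcup_seq => -[j /= js].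
  apply: tA Aix; rewrite ?inE ?eqxx ?js ?orbT//.
  by apply: contraNneq si => ->.
rewrite big_cons -/U; have -> : mu (A i `|` U) = (mu (A i) + mu U)%E.
  by apply: measureU => //; apply: bigsetU_measurable.
by rewrite Av IH -EFinD -natr1; congr EFin; ring.
Qed.

End disjoint_copies.

(** * Balls compared with unions of grid cubes *)

Section tiling.
Context (R : realType) (d : nat).
Hypothesis d0 : (0 < d)%N.
Local Notation Rd := (d.-tuple (measurableTypeR R)).
Local Notation edist := Defs.edist.
Local Notation mu := (lebesgue_Rd R d).
Local Notation r := (unit_volume_radius R d).
Local Notation C := (@apart R d).
Local Notation "0d" := (origin R d).
Variable lam : R.
Hypothesis lam0 : 0 <= lam.
Local Notation ZS S := (Z mu C lam S).
Local Notation f S := (lnZ S lam).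

Let mC := @measurable_apart R d.
Let symC := @apart_sym R d.

Let r_gt0 : 0 < r. Proof. by have [] := @unit_volume_radiusP R d d0. Qed.

Let volE (x : Rd) s : 0 < s -> mu (eball x s) = ((s / r) ^+ d)%:E.
Proof. by have [_] := @unit_volume_radiusP R d d0; apply. Qed.

Lemma Z_cube (a : Rd) l : ZS (cube a l) = ZS (cube 0d l).
Proof.
have -> : cube 0d l = aff 1 a @^-1` cube a l.
  apply/seteqP; split => x /= h i; move: (h i); rewrite !tnth_mktuple; lra.
rewrite (Z_preimage mC)//.
- exact: measurable_aff.
- by move=> A mA; rewrite lebesgue_aff// expr1n invr1 mul1e.
- by move=> x y; rewrite /apart/= edist_aff// mul1r.
- exact: measurable_cube.
Qed.

Lemma Z_cubes_le S (s : seq Rd) l (V : R) : 0 <= l -> measurable S -> mu S = V%:E ->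
  S `<=` \big[setU/set0]_(a <- s) cube a l -> f S <= (size s)%:R * f (cube 0d l).
Proof.
move=> l0 mS SV sub; have mQ a := @measurable_cube R d a l.
have vQ a : mu (cube a l) = (l ^+ d)%:E by exact: lebesgue_cube.
have [q q1 qE] := Z_finite mC lam0 (mQ 0d) (vQ 0d); have [b b1 bE] := Z_finite mC lam0 mS SV.
have : (ZS S <= \prod_(a <- s) ZS (cube a l))%E.
  apply: le_trans (Z_bigcup_le mC symC lam0 s mQ _); last by move=> a; rewrite vQ ltry.
  by apply: (Z_sub mu mC) => //; exact: bigsetU_measurable.
rewrite (eq_bigr (fun=> q%:E)); last by move=> a _; rewrite Z_cube.
rewrite prodEFin big_const_seq count_predT iter_mulr_1 bE lee_fin => H.
have q0 := lt_le_trans ltr01 q1; have b0 := lt_le_trans ltr01 b1.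
rewrite /lnZ bE qE /= mulr_natl -lnXn// ler_ln ?posrE ?exprn_gt0//.
Qed.

Lemma Z_cubes_ge S (s : seq Rd) l (V : R) : 0 <= l -> measurable S -> mu S = V%:E ->
  uniq s ->
  (forall a b x y, a \in s -> b \in s -> a != b -> cube a l x -> cube b l y -> 2 * r < edist x y) ->
  \big[setU/set0]_(a <- s) cube a l `<=` S -> (size s)%:R * f (cube 0d l) <= f S.
Proof.
move=> l0 mS SV us far sub; have mQ a := @measurable_cube R d a l.
have vQ a : mu (cube a l) = (l ^+ d)%:E by exact: lebesgue_cube.
have [q q1 qE] := Z_finite mC lam0 (mQ 0d) (vQ 0d); have [b b1 bE] := Z_finite mC lam0 mS SV.
(* [Z_bigcup_ge] asks for separation of all indices, so the sets off [s] are made empty. *)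
pose A a := if a \in s then cube a l else set0.
have mA a : measurable (A a) by rewrite /A; case: ifP.
have AE : \big[setU/set0]_(a <- s) A a = \big[setU/set0]_(a <- s) cube a l.
  by rewrite big_seq [RHS]big_seq; apply: eq_bigr => a as_; rewrite /A as_.
have : (\prod_(a <- s) ZS (cube a l) <= ZS S)%E.
  rewrite big_seq (eq_bigr (fun a => ZS (A a))); last by move=> a as_; rewrite /A as_.
  rewrite -big_seq; apply: (@le_trans _ _ (ZS (\big[setU/set0]_(a <- s) A a))).
    apply: (Z_bigcup_ge mC symC lam0) => //.
      by move=> a; rewrite /A; case: ifP => _; rewrite ?measure0// vQ ltry.
    move=> a a' u x aa'; rewrite /A; case: ifP => // as_; case: ifP => // as' au ax.
    split; first exact: far as_ as' aa' au ax.
    move=> aux; have := far _ _ _ _ as_ as' aa' aux ax.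
    rewrite ltNge => /negP; apply; rewrite edist_le; last by rewrite mulr_ge0 ?ltW.
    by rewrite big1 ?sqr_ge0// => i _; rewrite subrr expr0n.
  by rewrite AE; apply: (Z_sub mu mC) => //; exact: bigsetU_measurable.
rewrite (eq_bigr (fun=> q%:E)); last by move=> a _; rewrite Z_cube.
rewrite prodEFin big_const_seq count_predT iter_mulr_1 bE lee_fin => H.
have q0 := lt_le_trans ltr01 q1; have b0 := lt_le_trans ltr01 b1.
rewrite /lnZ bE qE /= mulr_natl -lnXn// ler_ln ?posrE ?exprn_gt0//.
Qed.

Section grid.
Variables (l : R) (m : nat).
Hypothesis l0 : 0 < l.

(** The shift by [m] centers the grid: the cubes of side [l] at these corners tile the half-open
    cube from [- l * m] to [l * m]. *)
Definition corner (z : {ffun 'I_d -> 'I_m.*2}) : Rd :=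
  [tuple l * ((z i)%:R - m%:R) | i < d].

Definition corners : seq Rd := [seq corner z | z <- enum {ffun 'I_d -> 'I_m.*2}].

Lemma corner_inj : injective corner.
Proof.
move=> z z' /(congr1 (fun t => tnth t)) zz'; apply/ffunP => i.
have := congr1 (fun t => t i) zz'; rewrite !tnth_mktuple => /(mulfI (lt0r_neq0 l0)).
move=> /addIr /eqP; rewrite eqr_nat => /eqP h; exact: val_inj.
Qed.

Lemma uniq_corners : uniq corners.
Proof. by rewrite map_inj_uniq ?enum_uniq//; exact: corner_inj. Qed.

(** In a coordinate where the corners differ they are at least [l] apart, while the cubes are
    half-open of side [l']. For [l' = l] this makes distinct cells disjoint; for [l = l' + 2 * r] it
    makes the cubes independent. *)
Lemma corners_gap a b l' x y : a \in corners -> b \in corners -> a != b ->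
  l' <= l -> cube a l' x -> cube b l' y -> l - l' < edist x y.
Proof.
move=> /mapP[z _ ->] /mapP[z' _ ->] zz' l'l xz yz'.
have {zz'} [i zi] : exists i, z i != z' i.
  apply/existsP; apply: contraNT zz' => /existsPn h; apply/eqP; congr corner.
  by apply/ffunP => i; apply/eqP; have := h i; rewrite negbK.
have := xz i; have := yz' i; rewrite !tnth_mktuple => /andP[y1 y2] /andP[x1 x2].
have gap : l - l' < `|tnth x i - tnth y i|.
  have lt_step (n n' : nat) : (n < n')%N -> 0 <= l * (n'%:R - (n%:R + 1)).
    by move=> nn'; rewrite mulr_ge0 ?(ltW l0)// subr_ge0 natr1 ler_nat.
  rewrite lter_normr; move: zi; rewrite -val_eqE/= neq_ltn.
  by move=> /orP[/lt_step h|/lt_step h]; apply/orP; [right|left]; lra.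
apply: (lt_le_trans gap); rewrite -sqrtr_sqr ler_wsqrtr// (bigD1 i)//= lerDl.
by apply: sumr_ge0 => j _; exact: sqr_ge0.
Qed.

Lemma corners_cover x : edist 0d x < l * m%:R -> exists2 a, a \in corners & cube a l x.
Proof.
move=> xlm.
have xi i : `|tnth x i| < l * m%:R.
  apply: le_lt_trans xlm; rewrite -sqrtr_sqr ler_wsqrtr// (bigD1 i)//=.
  rewrite tnth_mktuple sub0r sqrrN lerDl.
  by apply: sumr_ge0 => j _; exact: sqr_ge0.
pose y i := tnth x i / l + m%:R.
have y0 i : 0 <= y i.
  have := xi i; rewrite ltr_norml => /andP[h _].
  by rewrite -lerBlDr sub0r ler_pdivlMr// mulNr mulrC ltW.
have ym i : y i < m.*2%:R.
  have := xi i; rewrite ltr_norml => /andP[_ h].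
  by rewrite -addnn natrD ltrD2r ltr_pdivrMr// mulrC.
have zm i : (Num.truncn (y i) < m.*2)%N.
  rewrite -(ltr_nat R); apply: le_lt_trans (ym i).
  by have /andP[] := truncn_itv (y0 i).
exists (corner [ffun i => Ordinal (zm i)]).
  by apply: map_f; rewrite mem_enum.
move=> i; rewrite tnth_mktuple ffunE/=.
have /andP[h1 h2] := truncn_itv (y0 i).
have -> : tnth x i = l * (y i - m%:R).
  by rewrite /y addrK mulrC divfK// lt0r_neq0.
have -> : l * ((Num.truncn (y i))%:R - m%:R) + l = l * ((Num.truncn (y i)).+1%:R - m%:R).
  by rewrite -natr1; ring.
by rewrite ler_pM2l// lerD2r h1/= ltr_pM2l// ltrD2r.
Qed.

End grid.

Lemma corners_volume l m (s : seq Rd) : 0 < l -> uniq s -> {subset s <= corners l m} ->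
  mu (\big[setU/set0]_(a <- s) cube a l) = ((size s)%:R * l ^+ d)%:E.
Proof.
move=> l0 us sub; apply: measure_disjoint_copies => //.
- by move=> a; exact: measurable_cube.
- by move=> a; exact: (lebesgue_cube a (ltW l0)).
move=> a b x /sub as_ /sub bs ab ax bx.
have := corners_gap l0 as_ bs ab (lexx l) ax bx; rewrite subrr lt_neqAle => /andP[+ _].
by rewrite /Defs.edist big1 ?sqrtr0 ?eqxx// => i _; rewrite subrr expr0n.
Qed.

Let dl0 (l : R) : 0 < l -> 0 < d%:R * l.
Proof. by move=> l0; rewrite mulr_gt0// ltr0n. Qed.

(** The grid cubes that meet the ball cover it and lie in the ball of radius [rho + d * l];
    comparing volumes bounds their number. *)
Lemma lnZ_ball_le (rho l : R) : 0 < rho -> 0 < l ->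
  f (eball 0d rho) <= f (cube 0d l) / l ^+ d * ((rho + d%:R * l) / r) ^+ d.
Proof.
move=> rho0 l0; pose m := (Num.truncn (rho / l)).+1.
have rlm : rho < l * m%:R.
  have /andP[_] := truncn_itv (ltW (divr_gt0 rho0 l0)).
  by rewrite ltr_pdivrMr// mulrC.
pose s := [seq a <- corners l m | `[< cube a l `&` eball 0d rho !=set0 >]].
have us : uniq s by rewrite filter_uniq// uniq_corners.
have sub : {subset s <= corners l m} by move=> a; rewrite mem_filter => /andP[].
have mB t := @measurable_eball R d 0d t.
have vB := volE 0d rho0.
have cov : eball 0d rho `<=` \big[setU/set0]_(a <- s) cube a l.
  move=> x xB; have [a am ax] := corners_cover l0 (le_lt_trans xB rlm).
  rewrite -bigcup_seq; exists a => //=; rewrite mem_filter am andbT.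
  by apply/asboolP; exists x.
apply: (le_trans (Z_cubes_le (ltW l0) (mB rho) vB cov)).
have f0 : 0 <= f (cube 0d l).
  have := lnZ_ge0 (measurable_cube 0d l) (lebesgue_cube 0d (ltW l0)) lam0; exact.
rewrite mulrC -mulrA; apply: ler_wpM2l => //.
rewrite mulrC ler_pdivlMr ?exprn_gt0//.
have r1 : 0 < rho + d%:R * l by rewrite addr_gt0// dl0.
rewrite -lee_fin -(volE 0d r1) -(corners_volume l0 us sub).
apply: le_measure; rewrite ?inE; [|exact: mB|].
  by apply: bigsetU_measurable => a _; exact: measurable_cube.
move=> x; rewrite -bigcup_seq => -[a /=]; rewrite mem_filter => /andP[/asboolP[y [ya yB]] _] xa.
by apply: (edist_add_le rho0 (dl0 l0) yB); apply: (edist_cube (ltW l0) ya xa).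
Qed.

(** Cubes of side [l] at the corners of a grid of mesh [l + 2 * r] do not interact. The cells
    contained in the ball cover the ball of radius [rho - d * (l + 2 * r)], which bounds their
    number from below. *)
Lemma lnZ_ball_ge (rho l : R) : 0 < l -> d%:R * (l + 2 * r) < rho ->
  f (cube 0d l) / (l + 2 * r) ^+ d * ((rho - d%:R * (l + 2 * r)) / r) ^+ d <=
  f (eball 0d rho).
Proof.
move=> l0; set l1 := l + 2 * r => rhol.
have l10 : 0 < l1 by rewrite addr_gt0// mulr_gt0.
have ll1 : l <= l1 by rewrite lerDl mulr_ge0// ltW.
have rho0 : 0 < rho by apply: lt_trans rhol; exact: dl0.
pose m := (Num.truncn (rho / l1)).+1.
have rlm : rho < l1 * m%:R.
  have /andP[_] := truncn_itv (ltW (divr_gt0 rho0 l10)).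
  by rewrite ltr_pdivrMr// mulrC.
pose s := [seq a <- corners l1 m | `[< cube a l1 `<=` eball 0d rho >]].
have us : uniq s by rewrite filter_uniq// uniq_corners.
have sub : {subset s <= corners l1 m} by move=> a; rewrite mem_filter => /andP[].
have mB t := @measurable_eball R d 0d t.
have vB := volE 0d rho0.
have far a b x y : a \in s -> b \in s -> a != b -> cube a l x -> cube b l y ->
    2 * r < edist x y.
  move=> /sub as_ /sub bs ab ax bby.
  have := corners_gap l10 as_ bs ab ll1 ax bby.
  by rewrite /l1 addrAC subrr add0r.
have sB : \big[setU/set0]_(a <- s) cube a l `<=` eball 0d rho.
  move=> x; rewrite -bigcup_seq => -[a /=]; rewrite mem_filter => /andP[/asboolP aB _] xa.
  apply: aB => i; have /andP[h1 h2] := xa i; rewrite h1/=.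
  by apply: lt_le_trans h2 _; rewrite lerD2l.
apply: le_trans (Z_cubes_ge (ltW l0) (mB rho) vB us far sB).
have f0 : 0 <= f (cube 0d l).
  have := lnZ_ge0 (measurable_cube 0d l) (lebesgue_cube 0d (ltW l0)) lam0; exact.
rewrite [leRHS]mulrC -mulrA; apply: ler_wpM2l => //.
rewrite mulrC ler_pdivrMr ?exprn_gt0//.
have r1 : 0 < rho - d%:R * l1 by rewrite subr_gt0.
rewrite -lee_fin -(volE 0d r1) -(corners_volume l10 us sub).
apply: le_measure; rewrite ?inE; [exact: mB| |].
  by apply: bigsetU_measurable => a _; exact: measurable_cube.
move=> x xB; have xrho : edist 0d x < l1 * m%:R.
  by apply: le_lt_trans rlm; apply: le_trans xB _; rewrite gerBl ltW// dl0.
have [a am ax] := corners_cover l10 xrho.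
rewrite -bigcup_seq; exists a => //=; rewrite mem_filter am andbT.
apply/asboolP => y ya; rewrite /eball/= -[rho](subrK (d%:R * l1)).
apply: (edist_add_le r1 (dl0 l10) xB); exact: (edist_cube (ltW l10) ax ya).
Qed.

End tiling.

(** * Convergence along the balls of volume [n] *)

Section pressure_limit.
Context (R : realType) (d : nat).
Hypothesis d0 : (0 < d)%N.
Local Notation Rd := (d.-tuple (measurableTypeR R)).
Local Notation mu := (lebesgue_Rd R d).
Local Notation r := (unit_volume_radius R d).
Local Notation C := (@apart R d).
Local Notation "0d" := (origin R d).
Variable lam : R.
Hypothesis lam0 : 0 <= lam.
Local Notation f S := (lnZ S lam).

Let r_gt0 : 0 < r. Proof. by have [] := @unit_volume_radiusP R d d0. Qed.

Let rho n : R := n%:R `^ d%:R^-1 * r.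

Let rho_gt0 n : (0 < n)%N -> 0 < rho n.
Proof. by move=> n0; rewrite mulr_gt0// powR_gt0// ltr0n. Qed.

Let rhoX n : (rho n / r) ^+ d = n%:R.
Proof.
rewrite /rho mulfK ?lt0r_neq0// -powR_mulrn ?powR_ge0// -powRrM mulVf.
  by rewrite powRr1.
by rewrite pnatr_eq0 -lt0n.
Qed.

Lemma volume_ballE n : (0 < n)%N -> mu (@volume_ball R d n) = n%:R%:E.
Proof.
move=> n0; rewrite /volume_ball; have [_ ->] := @unit_volume_radiusP R d d0.
  by rewrite rhoX.
exact: rho_gt0.
Qed.

Lemma measurable_volume_ball n : measurable (@volume_ball R d n).
Proof. exact: measurable_eball. Qed.

Lemma log_partition_volume_ball n : (0 < n)%N ->
  lne (Zpart (@volume_ball R d n) lam) = (f (@volume_ball R d n))%:E.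
Proof.
move=> n0; have mB := measurable_volume_ball n.
rewrite Zpart_Z//; have [q q1 qE] := Z_finite (@measurable_apart R d) lam0 mB (volume_ballE n0).
by rewrite /lnZ qE lne_EFin// (lt_le_trans _ q1).
Qed.

Let x n := (rho n)^-1.

Let x_cvg0 : x @ \oo --> (0 : R).
Proof.
apply/cvgrPdist_le => /= e e0; near=> n.
have n0 : (0 < n)%N by near: n; exact: nbhs_infty_gt.
have rn := rho_gt0 n0; have rn' := ltW rn; have r0' := ltW r_gt0; have e0' := ltW e0.
rewrite sub0r normrN /x ger0_norm ?invr_ge0//.
rewrite -(invrK e) lef_pV2 ?posrE ?invr_gt0//.
rewrite -(@ler_pM2r _ r^-1) ?invr_gt0// -(@ler_pXn2r _ d)//; last 2 first.
- by rewrite nnegrE divr_ge0 ?invr_ge0.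
- by rewrite nnegrE divr_ge0.
rewrite rhoX; apply: ltW; near: n; exact: nbhs_infty_gtr.
Unshelve. all: by end_near. Qed.

Let cvg_exprn (u : R^nat) (a : R) k : u @ \oo --> a -> (fun n => u n ^+ k) @ \oo --> a ^+ k.
Proof.
by move=> ua; apply: (@cvg_comp _ _ _ u (fun y : R => y ^+ k) _ _ _ ua); exact: exprn_continuous.
Qed.

Let affX_cvg (a b : R) (u : R^nat) : u @ \oo --> (0 : R) ->
  (fun n => a * (1 + b * u n) ^+ d) @ \oo --> a.
Proof.
move=> u0; have h : (fun n => 1 + b * u n) @ \oo --> (1 : R).
  rewrite -[X in _ --> X]addr0 -[X in _ + X](mulr0 b).
  by apply: cvgD; [exact: cvg_cst|apply: cvgM => //; exact: cvg_cst].
have := cvgM (cvg_cst a) (@cvg_exprn _ _ d h).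
by rewrite expr1n mulr1; exact.
Qed.

Let ball_upper n l : (0 < n)%N -> 0 < l ->
  n%:R^-1 * f (@volume_ball R d n) <= f (cube 0d l) / l ^+ d * (1 + d%:R * l * x n) ^+ d.
Proof.
move=> n0 l0; have nR : 0 < n%:R :> R by rewrite ltr0n.
rewrite mulrC ler_pdivrMr//; apply: (le_trans (lnZ_ball_le d0 lam0 (rho_gt0 n0) l0)).
rewrite -[leRHS]mulrA -(rhoX n) -[X in _ <= _ * X]exprMn.
have -> : (1 + d%:R * l * x n) * (rho n / r) = (rho n + d%:R * l) / r.
  by rewrite /x; field; rewrite !lt0r_neq0// rho_gt0.
by [].
Qed.

Let ball_lower n l : (0 < n)%N -> 0 < l -> d%:R * (l + 2 * r) < rho n ->
  f (cube 0d l) / (l + 2 * r) ^+ d * (1 + - (d%:R * (l + 2 * r)) * x n) ^+ d <=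
  n%:R^-1 * f (@volume_ball R d n).
Proof.
move=> n0 l0 ln; have nR : 0 < n%:R :> R by rewrite ltr0n.
rewrite [leRHS]mulrC ler_pdivlMr//; apply: le_trans (lnZ_ball_ge d0 lam0 l0 ln).
rewrite -[leLHS]mulrA -(rhoX n) -[X in _ * X <= _]exprMn.
have -> : (1 + - (d%:R * (l + 2 * r)) * x n) * (rho n / r) = (rho n - d%:R * (l + 2 * r)) / r.
  by rewrite /x; field; rewrite !lt0r_neq0// rho_gt0.
by [].
Qed.

Let dens : set R := [set a | exists2 l, 0 < l & a = f (cube 0d l) / l ^+ d].

Let fcube_ge0 l : 0 < l -> 0 <= f (cube 0d l).
Proof.
by move=> l0; have := lnZ_ge0 (measurable_cube 0d l) (lebesgue_cube 0d (ltW l0)) lam0; exact.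
Qed.

Let dens_lb : lbound dens 0.
Proof. by move=> _ [l l0 ->]; rewrite divr_ge0 ?fcube_ge0// exprn_ge0// ltW. Qed.

Let dens_inf : has_inf dens.
Proof. by split; [exists (f (cube 0d 1) / 1 ^+ d); exists 1|exists 0]. Qed.

(** A nearly optimal cube gives the upper bound by covering. For the lower bound any cube has
    density at least the infimum [p], and a large one is taken so that the gaps between cubes cost
    little. With both sides fixed, the boundary corrections vanish as the radius grows. *)
Lemma log_partition_cvg :
  (fun n => n%:R^-1 * f (@volume_ball R d n)) @ \oo --> inf dens.
Proof.
set p := inf dens.
have p0 : 0 <= p by apply: lb_le_inf => //; exact: dens_inf.1.
apply/cvgrPdist_le => /= e e0.
have [_ [l1 l10 ->] l1p] := inf_adherent e0 dens_inf.
(* The ratio [l / (l + 2 * r)] is the share of a grid step filled by the cube; it tends to 1 along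
   the sides [l = k.+1]. *)
have [l2 l20 l2p] : exists2 l, 0 < l & p - e < p * (l / (l + 2 * r)) ^+ d.
  pose w (k : nat) : R := (1 + 2 * r * k.+1%:R^-1)^-1.
  have wE k : w k = k.+1%:R / (k.+1%:R + 2 * r).
    have k0 : 0 < k.+1%:R :> R by [].
    rewrite /w; field.
    by rewrite !lt0r_neq0// addr_gt0 ?mulr_gt0.
  have h1 : (fun k => 1 + 2 * r * k.+1%:R^-1) @ \oo --> (1 : R).
    rewrite -[X in _ --> X]addr0 -[X in _ + X](mulr0 (2 * r)).
    apply: cvgD; first exact: cvg_cst.
    by apply: cvgM; [exact: cvg_cst|exact: cvg_harmonic].
  have h2 : w @ \oo --> (1 : R).
    by rewrite -[X in _ --> X]invr1; apply: cvgV => //; exact: oner_neq0.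
  have h3 : (fun k => p * (w k) ^+ d) @ \oo --> p.
    have := cvgM (cvg_cst p) (@cvg_exprn _ _ d h2).
    by rewrite expr1n mulr1; exact.
  have pe : p - e < p by rewrite ltrBlDr ltrDl.
  have [k _ /(_ k (leqnn k))] := cvgr_gt _ h3 _ pe.
  by rewrite /= wE => h; exists k.+1%:R.
pose a2 := f (cube 0d l2) / (l2 + 2 * r) ^+ d.
have l2r : 0 < l2 + 2 * r by rewrite addr_gt0// mulr_gt0.
have pa2 : p * (l2 / (l2 + 2 * r)) ^+ d <= a2.
  have : p <= f (cube 0d l2) / l2 ^+ d.
    by apply: (ge_inf dens_inf.2); exists l2.
  have l2d : 0 < l2 ^+ d by rewrite exprn_gt0.
  move=> /(ler_wpM2r (exprn_ge0 d (divr_ge0 (ltW l20) (ltW l2r)))) /le_trans; apply.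
  by rewrite expr_div_n mulrA divfK// lt0r_neq0.
have near_up := cvgr_lt _ (@affX_cvg (f (cube 0d l1) / l1 ^+ d) (d%:R * l1) _ x_cvg0) _ l1p.
have near_lo := cvgr_gt _ (@affX_cvg a2 (- (d%:R * (l2 + 2 * r))) _ x_cvg0) _ (lt_le_trans l2p pa2).
have dl : 0 < d%:R * (l2 + 2 * r) by rewrite mulr_gt0// ltr0n.
have dli : 0 < (d%:R * (l2 + 2 * r))^-1 by rewrite invr_gt0.
have near_x := cvgr_lt _ x_cvg0 _ dli.
near=> n.
have n0 : (0 < n)%N by near: n; exact: nbhs_infty_gt.
have up : f (cube 0d l1) / l1 ^+ d * (1 + d%:R * l1 * x n) ^+ d < p + e.
  by near: n; exact: near_up.
have lo : p - e < a2 * (1 + - (d%:R * (l2 + 2 * r)) * x n) ^+ d.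
  by near: n; exact: near_lo.
have rn : d%:R * (l2 + 2 * r) < rho n.
  have xn : x n < (d%:R * (l2 + 2 * r))^-1 by near: n; exact: near_x.
  by move: xn; rewrite /x ltf_pV2// posrE rho_gt0.
have := ball_upper n0 l10; have := ball_lower n0 l20 rn.
rewrite -/a2 => h1 h2; rewrite ler_norml; apply/andP; split; lra.
Unshelve. all: by end_near. Qed.

(** [limn] carries information only for convergent sequences, so [log_partition_cvg] has to come
    before the passage to the limit. *)
Lemma pressure_ge (b : R) :
  (forall n, (0 < n)%N -> n%:R * b <= f (@volume_ball R d n)) ->
  (b%:E <= pressure d lam)%E.
Proof.
move=> hb.
have vE : (fun n => (n%:R^-1)%:E * lne (Zpart (@volume_ball R d n) lam))%E =
    EFin \o (fun n => n%:R^-1 * f (@volume_ball R d n)).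
  (* At [n = 0] the factor [0^-1] is 0, so both sequences vanish there. *)
  apply/funext => -[|n]; first by rewrite /= invr0 mul0e mul0r.
  by rewrite log_partition_volume_ball// EFinM.
have vcv := cvgP _ log_partition_cvg.
rewrite /pressure vE EFin_lim// lee_fin; apply: limr_ge => //.
near=> n; have n0 : (0 < n)%N by near: n; exact: nbhs_infty_gt.
by rewrite mulrC ler_pdivlMr ?ltr0n// mulrC; exact: hb.
Unshelve. all: by end_near. Qed.

End pressure_limit.

(** * The error term as the dimension grows *)

Section rate.
Context (R : realType) (c : R).
Hypothesis hc : ln 3 / 2 <= c < ln 2.

Let L := ln 2 - c.
Let L0 : 0 < L. Proof. by rewrite subr_gt0; case/andP: hc. Qed.

Let n (d : nat) := Num.truncn (Num.sqrt d%:R : R).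
Let u d : R := (n d).+2%:R^-1.
Let h d := L * d%:R / (n d).+2%:R.
Let x d := expR (- h d).
(** The product [(1 - u d) * (1 - 2 * u d)] is [n (n + 1) / (n + 2)^2], the loss from the finite
    grid; the denominator is the one in [lnZ_ge]. *)
Let theta d := (1 - u d) * (1 - 2 * u d) / (x d + (1 - 2 * x d)^-1).

(* The grid has [n d].+2 steps of log-fugacity length [h d]; both tend to infinity. *)
Definition rate d : R :=
  if 2 * x d < 1 then L ^+ 2 / 2 * (theta d - 1) else - (L ^+ 2 / 2).

Lemma pressure_rate d : (0 < d)%N ->
  (((L ^+ 2 / 2 + rate d) * (d%:R ^+ 2 / 2 ^+ d))%:E <= pressure d (expR (- (c * d%:R))))%E.
Proof.
move=> d0; apply: (pressure_ge d0 (expR_ge0 _)).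
move=> k k0; have mB := @measurable_volume_ball R d k.
have vB := volume_ballE R d0 k0.
(* In the default branch the coefficient vanishes, so nonnegativity of [lnZ] is enough. *)
rewrite /rate; case: ifPn => [x1|_]; last first.
  by rewrite addrN mul0r mulr0; apply: (lnZ_ge0 mB vB); exact: expR_ge0.
have n0 : (n d).+2%:R != 0 :> R by rewrite pnatr_eq0.
have h0 : 0 < h d by rewrite divr_gt0// mulr_gt0// ltr0n.
have hn : (n d).+2%:R * h d = (ln 2 - c) * d%:R by rewrite mulrC divfK.
have := lnZ_ge d0 mB vB (proj1 (andP hc)) h0 hn x1.
apply: le_trans; rewrite le_eqVlt; apply/orP; left; apply/eqP; congr (_ * _).
rewrite -/(x d) /theta.
have D0 : x d + (1 - 2 * x d)^-1 != 0.
  by rewrite lt0r_neq0// addr_gt0 ?expR_gt0// invr_gt0 subr_gt0.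
move: (x d + _) D0 => D D0.
have p0 : 2 ^+ d != 0 :> R by rewrite expf_neq0.
move: (2 ^+ d) p0 => p p0; rewrite /h /u -!natr1; rewrite -!natr1 in n0.
by field; rewrite n0 D0 p0.
Qed.

Let y (d : nat) : R := (Num.sqrt d%:R)^-1.

Let y_cvg : y @ \oo --> (0 : R).
Proof.
apply/cvgrPdist_le => /= e e0; near=> d.
have d0 : (0 < d)%N by near: d; exact: nbhs_infty_gt.
have s0 : 0 < Num.sqrt d%:R :> R by rewrite sqrtr_gt0 ltr0n.
rewrite sub0r normrN ger0_norm ?invr_ge0 ?sqrtr_ge0//.
rewrite -(invrK e) lef_pV2 ?posrE ?invr_gt0//.
rewrite -[leLHS]ger0_norm ?invr_ge0 ?(ltW e0)// -sqrtr_sqr ler_wsqrtr//.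
by apply: ltW; near: d; exact: nbhs_infty_gtr.
Unshelve. all: by end_near. Qed.

Let n_bounds d : (n d)%:R <= Num.sqrt (d%:R : R) < (n d).+1%:R.
Proof. by apply: truncn_itv; exact: sqrtr_ge0. Qed.

Let u_cvg : u @ \oo --> (0 : R).
Proof.
apply: (squeeze_cvgr _ (cvg_cst 0) y_cvg); near=> d.
have d0 : (0 < d)%N by near: d; exact: nbhs_infty_gt.
have s0 : 0 < Num.sqrt d%:R :> R by rewrite sqrtr_gt0 ltr0n.
rewrite invr_ge0 ler0n/= lef_pV2 ?posrE//.
have /andP[_ /ltW h1] := n_bounds d; apply: (le_trans h1).
by rewrite ler_nat.
Unshelve. all: by end_near. Qed.

Let x_cvg : x @ \oo --> (0 : R).
Proof.
(* The bound [expR (- h d) <= (h d)^-1] suffices, and [n d + 2 <= 3 * Num.sqrt d] bounds [h d] below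
   by [L * Num.sqrt d / 3]. *)
have yL : (fun d => 3 / L * y d) @ \oo --> (0 : R).
  by rewrite -[X in _ --> X](mulr0 (3 / L)); apply: cvgM => //; exact: cvg_cst.
apply: (squeeze_cvgr _ (cvg_cst 0) yL); near=> d.
have d0 : (0 < d)%N by near: d; exact: nbhs_infty_gt.
have s1 : 1 <= Num.sqrt d%:R :> R by rewrite -[leLHS]sqrtr1 ler_wsqrtr// ler1n.
have s0 : 0 < Num.sqrt d%:R :> R by exact: lt_le_trans s1.
rewrite expR_ge0/=.
have h0 : 0 < h d by rewrite divr_gt0// mulr_gt0// ltr0n.
apply: (@le_trans _ _ (h d)^-1).
  rewrite /x expRN lef_pV2 ?posrE ?expR_gt0//.
  by apply: le_trans (expR_ge1Dx (h d)); rewrite lerDr.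
have -> : 3 / L * y d = (L * Num.sqrt d%:R / 3)^-1.
  by rewrite /y; field; rewrite !lt0r_neq0.
rewrite lef_pV2 ?posrE ?divr_gt0 ?mulr_gt0//.
rewrite /h -!mulrA ler_pM2l// ler_pdivlMr// mulrAC ler_pdivrMr//.
have sd : Num.sqrt d%:R * Num.sqrt d%:R = d%:R :> R by rewrite -expr2 sqr_sqrtr.
rewrite -[X in _ <= X * _]sd -mulrA ler_pM2l// -!natr1.
  by have /andP[h1 _] := n_bounds d; lra.
by rewrite ltr0n.
Unshelve. all: by end_near. Qed.

(** Since [x d] tends to 0, the default branch is left for all large [d]; there [theta d] tends to 1
    because [u d] and [x d] both vanish in the limit. *)
Lemma rate_cvg0 : rate @ \oo --> (0 : R).
Proof.
have aff (a : R) v : v @ \oo --> (0 : R) -> (fun d => 1 - a * v d) @ \oo --> (1 : R).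
  move=> v0; rewrite -[X in _ --> X]subr0 -[X in _ - X](mulr0 a).
  by apply: cvgB; [exact: cvg_cst|apply: cvgM => //; exact: cvg_cst].
have u1 : (fun d => 1 - u d) @ \oo --> (1 : R).
  by rewrite -[X in _ --> X]subr0; apply: cvgB => //; exact: cvg_cst.
have th : theta @ \oo --> (1 : R).
  have := cvgM (cvgM u1 (aff 2 u u_cvg))
    (cvgV _ (cvgD x_cvg (cvgV (oner_neq0 R) (aff 2 x x_cvg)))).
  rewrite add0r !invr1 !mul1r; apply; exact: oner_neq0.
have lim : (fun d => L ^+ 2 / 2 * (theta d - 1)) @ \oo --> (0 : R).
  have := cvgM (cvg_cst (L ^+ 2 / 2 : R)) (cvgB th (cvg_cst (1 : R))).
  by rewrite subrr mulr0; exact.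
apply: cvg_trans lim; apply: near_eq_cvg; near=> d.
rewrite /rate ifT// -subr_gt0; near: d.
exact: (cvgr_gt _ (aff 2 x x_cvg) _ ltr01).
Unshelve. all: by end_near. Qed.

End rate.

Theorem theorem4 (R : realType) (c : R) (hc : ln 3 / 2 <= c < ln 2) :
  exists2 o : R^nat, o @ \oo --> (0 : R) &
    forall d : nat, (0 < d)%N ->
      ((((ln 2 - c) ^+ 2 / 2 + o d) * (d%:R ^+ 2 / 2 ^+ d))%:E
       <= pressure d (expR (- (c * d%:R))))%E.
Proof.
exists (rate c); first exact: rate_cvg0.
by move=> d d0; exact: pressure_rate.
Qed.
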